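(* Let $q$ be any power of a prime number and let $G=\operatorname{PGL}_2(q)$. Let $\Gamma_{G}$ be the derangement graph of $G$ acting on the projective line $\operatorname{PG}_1(q)$. Then, as subgroups of $\operatorname{Sym}(G)$, $$\operatorname{Aut}(\Gamma_{G}) = \left(L_{G}\times R_{G}\right)\rtimes\left(\langle \psi\rangle\times \gamma_{\operatorname{Aut}(\mathbb{F}_q)}\right),$$ where $L_G$ and $R_G$ are the left-regular and right-regular representations of $G$, $\gamma_{\operatorname{Aut}(\mathbb{F}_q)}$ is the group of conjugations of $G$ by elements of $\operatorname{Aut}(\mathbb{F}_q)$, and $\psi:G\to G$ is the map $\psi(x)=x^{-1}$.
   Context: $\operatorname{PG}_1(q)=\mathbb{F}_q\cup\{\infty\}$ is the set of $1$-dimensional subspaces of $\mathbb{F}_q^2$, and $\operatorname{PGL}_2(q)$ (i.e. $\operatorname{GL}_2(\mathbb{F}_q)$ modulo scalar matrices) acts faithfully on it in the natural way, by Möbius transformations. For a finite transitive permutation group $G\leqslant\operatorname{Sym}(\Omega)$, a derangement is an element of $G$ fixing no point of $\Omega$. The derangement graph $\Gamma_G$ is the simple undirected graph with vertex set $G$ in which $g,h\in G$ are adjacent if and only if $h^{-1}g$ is a derangement. $\operatorname{Aut}(\Gamma_G)\leqslant\operatorname{Sym}(G)$ is its full automorphism group. For $g\in G$, let $\lambda_g,\rho_g:G\to G$ be $\lambda_g(x)=gx$ and $\rho_g(x)=xg^{-1}$. Set $L_G=\{\lambda_g:g\in G\}$ and $R_G=\{\rho_g:g\in G\}$, subgroups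 of $\operatorname{Sym}(G)$. Each $\alpha\in\operatorname{Aut}(\mathbb{F}_q)$ acts on $\operatorname{PG}_1(q)$ coordinatewise (fixing $\infty$); conjugation by this permutation, $\gamma_\alpha(x)=\alpha x\alpha^{-1}$, maps $\operatorname{PGL}_2(q)$ to itself (it applies $\alpha$ to the matrix entries). $\gamma_{\operatorname{Aut}(\mathbb{F}_q)}=\{\gamma_\alpha:\alpha\in\operatorname{Aut}(\mathbb{F}_q)\}\leqslant\operatorname{Sym}(\operatorname{PGL}_2(q))$. The direct and semidirect products are internal products of subgroups of $\operatorname{Sym}(G)$; in $N\rtimes H$ the subgroup $N$ is the normal one. *)

(* Defs.v *)
From HB Require Import structures.
From mathcomp Require Import all_boot all_algebra all_fingroup.

Set Implicit Arguments.
Unset Strict Implicit.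
Unset Printing Implicit Defensive.

Import GRing.Theory.
Local Open Scope group_scope.

(* The group law of {perm T} is composition in diagrammatic order,            *)
(* (s * t) x = t (s x); hence s ^ a = a^-1 * s * a is the permutation that is *)
(* usually written a \o s \o a^-1.                                            *)

Section RegularRepresentations.
Variable gT : finGroupType.

Definition lambda (g : gT) : {perm gT} := perm (mulgI g).
Definition rho (g : gT) : {perm gT} := perm (mulIg g^-1).
Definition psi : {perm gT} := perm (@invg_inj gT).

Lemma lambdaE g x : lambda g x = g * x. Proof. by rewrite permE. Qed.
Lemma rhoE g x : rho g x = x * g^-1. Proof. by rewrite permE. Qed.
Lemma psiE x : psi x = x^-1. Proof. by rewrite permE. Qed.

Definition left_regular : {set {perm gT}} := [set lambda g | g : gT].
Definition right_regular : {set {perm gT}} := [set rho g | g : gT].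

Lemma left_regular_group_set : group_set left_regular.
Proof.
apply/group_setP; split.
  by apply/imsetP; exists 1 => //; apply/permP=> x; rewrite lambdaE perm1 mul1g.
move=> _ _ /imsetP[g _ ->] /imsetP[h _ ->]; apply/imsetP; exists (h * g) => //.
by apply/permP=> x; rewrite permM !lambdaE mulgA.
Qed.
Canonical left_regular_group := Group left_regular_group_set.

Lemma right_regular_group_set : group_set right_regular.
Proof.
apply/group_setP; split.
  apply/imsetP; exists 1 => //.
  by apply/permP=> x; rewrite rhoE perm1 invg1 mulg1.
move=> _ _ /imsetP[g _ ->] /imsetP[h _ ->]; apply/imsetP; exists (h * g) => //.
by apply/permP=> x; rewrite permM !rhoE invMg mulgA.
Qed.
Canonical right_regular_group := Group right_regular_group_set.

End RegularRepresentations.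

Section GraphAutomorphisms.
Variables (V : finType) (e : rel V).

Definition graph_aut : {set {perm V}} :=
  [set s : {perm V} | [forall x, forall y, e (s x) (s y) == e x y]].

Lemma graph_autP (s : {perm V}) :
  reflect (forall x y, e (s x) (s y) = e x y) (s \in graph_aut).
Proof.
rewrite inE; apply: (iffP forallP) => [es x y | es x].
  by apply/eqP; move/forallP: (es x).
by apply/forallP=> y; apply/eqP.
Qed.

Lemma graph_aut_group_set : group_set graph_aut.
Proof.
apply/group_setP; split; first by apply/graph_autP=> x y; rewrite !perm1.
move=> s t /graph_autP es /graph_autP et; apply/graph_autP=> x y.
by rewrite !permM et es.
Qed.
Canonical graph_aut_group := Group graph_aut_group_set.

End GraphAutomorphisms.

Definition derangement (T : finType) (s : {perm T}) : bool :=
  [forall x, s x != x].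


Section ProjectiveLine.
Variable F : finFieldType.

HB.instance Definition _ := Countable.copy {vspace 'cV[F]_2}
  (can_type (@VectorInternalTheory.vs2mxK F 'cV[F]_2)).
HB.instance Definition _ := isFinite.Build {vspace 'cV[F]_2}
  (pcan_enumP (can_pcan (@VectorInternalTheory.vs2mxK F 'cV[F]_2))).

Definition PG1 := {U : {vspace 'cV[F]_2} | \dim U == 1%N}.
HB.instance Definition _ := SubFinite.on PG1.

Fact line_subproof (v : 'cV[F]_2) (v_neq0 : v != 0%R) : \dim <[v]> == 1%N.
Proof. by rewrite dim_vline v_neq0. Qed.
Definition line (v : 'cV[F]_2) (v_neq0 : v != 0%R) : PG1 :=
  exist _ <[v]>%VS (line_subproof v_neq0).

Lemma vpick_PG1 (P : PG1) : vpick (\val P) != 0%R.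
Proof. by rewrite vpick0 -dimv_eq0 (eqP (valP P)). Qed.

Lemma PG1_vline (P : PG1) v : v \in \val P -> v != 0%R -> \val P = <[v]>%VS.
Proof.
move=> Pv v0; apply/esym/eqP; rewrite eqEdim -memvE Pv dim_vline v0.
by rewrite (eqP (valP P)).
Qed.

Lemma PG1E (P : PG1) : {v : 'cV[F]_2 & {v0 : v != 0%R | P = line v0}}.
Proof.
exists (vpick (\val P)), (vpick_PG1 P).
by apply/val_inj/PG1_vline; rewrite ?memv_pick ?vpick_PG1.
Qed.

Definition gl_lfun (A : {'GL_2[F]}) : 'End('cV[F]_2) :=
  linfun (mulmx (GLval A : 'M[F]_2)).

Lemma lker_GL A : lker (gl_lfun A) == 0%VS.
Proof.
apply/lker0P=> u v; rewrite !lfunE /= => /(congr1 (mulmx (invmx (GLval A)))).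
by rewrite !mulKmx // GL_unitmx.
Qed.

Fact gl_act_subproof (A : {'GL_2[F]}) (P : PG1) :
  \dim (gl_lfun A @: \val P)%VS == 1%N.
Proof. by rewrite limg_dim_eq ?(eqP (valP P)) // (eqP (lker_GL A)) capv0. Qed.
Definition gl_act (A : {'GL_2[F]}) (P : PG1) : PG1 :=
  exist _ (gl_lfun A @: \val P)%VS (gl_act_subproof A P).

Lemma gl_act_line (A : {'GL_2[F]}) v (v0 : v != 0%R) :
  \val (gl_act A (line v0)) = <[((GLval A : 'M[F]_2) *m v)%R]>%VS.
Proof. by rewrite /= limg_line lfunE. Qed.

Lemma gl_actM (A B : {'GL_2[F]}) P :
  gl_act (A * B) P = gl_act A (gl_act B P).
Proof.
apply/val_inj => /=; rewrite -limg_comp; congr (_ @: _)%VS.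
by apply/lfunP=> v; rewrite comp_lfunE !lfunE; apply/esym/mulmxA.
Qed.

Lemma gl_act1 P : gl_act 1 P = P.
Proof.
by have [v [v0 ->]] := PG1E P; apply: val_inj; rewrite gl_act_line mul1mx.
Qed.

Definition scalars : {set {'GL_2[F]}} :=
  [set A : {'GL_2[F]} | is_scalar_mx (GLval A)].

Lemma scalarsP (A : {'GL_2[F]}) :
  reflect (forall P, gl_act A P = P) (A \in scalars).
Proof.
rewrite inE; apply: (iffP is_scalar_mxP) => [[a Aa] P | fixA].
  have [v [v0 ->]] := PG1E P; apply: val_inj; rewrite gl_act_line Aa.
  rewrite mul_scalar_mx; apply/esym/(PG1_vline (P := line v0)) => /=.
    by rewrite memvZ ?memv_line.
  rewrite scaler_eq0 (negPf v0) orbF; apply: contraTneq (GL_unitmx A) => a0.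
  by rewrite [val A]Aa a0 unitmxE det_scalar expr0n unitr0.
have eig (v : 'cV[F]_2) : v != 0%R -> exists a : F,
    ((GLval A : 'M[F]_2) *m v)%R = (a *: v)%R.
  move=> v0; have /(congr1 val) := fixA (line v0); rewrite gl_act_line /= => e.
  by apply/vlineP; rewrite -e memv_line.
have e_neq0 (i : 'I_2) : (delta_mx i 0%R : 'cV[F]_2) != 0%R.
  by apply/eqP=> /matrixP/(_ i 0%R); rewrite !mxE !eqxx => /eqP; rewrite oner_eq0.
have Acol (i j : 'I_2) : 
    GLval A i j = ((GLval A : 'M[F]_2) *m (delta_mx j 0%R : 'cV[F]_2))%R i 0%R.
  by rewrite -colE mxE.
have offdiag (i j : 'I_2) : i != j -> GLval A i j = 0%R.
  move=> nij; have [a ea] := eig _ (e_neq0 j).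
  by rewrite Acol ea !mxE (negPf nij) mulr0.
have s_neq0 : (const_mx 1%R : 'cV[F]_2) != 0%R.
  by apply/eqP=> /matrixP/(_ 0%R 0%R); rewrite !mxE => /eqP; rewrite oner_eq0.
have [a /matrixP ea] := eig _ s_neq0; exists a; apply/matrixP=> i j.
rewrite mxE; have [-> | nij] := eqVneq i j; last by rewrite offdiag.
have := ea j 0%R; rewrite !mxE (bigD1 j) //= big1 => [|k nkj]; last first.
  by rewrite offdiag ?mul0r // eq_sym.
by rewrite mxE !mulr1 addr0 mulr1n.
Qed.

Lemma scalars_group_set : group_set scalars.
Proof.
apply/group_setP; split; first by apply/scalarsP=> P; rewrite gl_act1.
move=> A B /scalarsP fixA /scalarsP fixB; apply/scalarsP=> P.
by rewrite gl_actM fixB fixA.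
Qed.
Canonical scalars_group := Group scalars_group_set.

Lemma norm_scalars (A : {'GL_2[F]}) : A \in 'N(scalars).
Proof.
rewrite -groupV inE; apply/subsetP=> _ /imsetP[B /scalarsP fixB ->].
apply/scalarsP=> P; rewrite conjgE invgK !gl_actM fixB -gl_actM mulgV.
exact: gl_act1.
Qed.

(* [coset_of H] is the quotient by H of the normaliser of H, which for the    *)
(* scalars is all of GL_2(F).                                                 *)
Definition PGL2 : finGroupType := coset_of scalars.

Lemma PGL2P (x : PGL2) : exists A : {'GL_2[F]}, x = coset scalars A.
Proof. by exists (repr x); rewrite coset_reprK. Qed.

Definition pgl_act (x : PGL2) (P : PG1) : PG1 := gl_act (repr x) P.

Lemma pgl_act_coset (A : {'GL_2[F]}) P :
  pgl_act (coset scalars A) P = gl_act A P.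
Proof.
have : repr (coset scalars A) \in scalars :* A.
  by rewrite -val_coset ?norm_scalars //; apply: mem_repr_coset.
by rewrite /pgl_act => /rcosetP[B /scalarsP fixB ->]; rewrite gl_actM fixB.
Qed.

Lemma pgl_actM x y P : pgl_act (x * y) P = pgl_act x (pgl_act y P).
Proof.
have [[A ->] [B ->]] := (PGL2P x, PGL2P y).
by rewrite -morphM ?norm_scalars // !pgl_act_coset gl_actM.
Qed.

Lemma pgl_act1 P : pgl_act 1 P = P.
Proof. by rewrite -(morph1 (coset scalars)) pgl_act_coset gl_act1. Qed.

Lemma pgl_act_inj x : injective (pgl_act x).
Proof.
by apply: (@can_inj _ _ _ (pgl_act x^-1)) => P; rewrite -pgl_actM mulVg pgl_act1.
Qed.

Definition pgl_perm (x : PGL2) : {perm PG1} := perm (@pgl_act_inj x).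

Lemma pgl_perm_inj : injective pgl_perm.
Proof.
move=> x y exy; have [[A eA] [B eB]] := (PGL2P x, PGL2P y).
suffices: coset scalars (A^-1 * B) = 1.
  rewrite morphM ?morphV ?norm_scalars //= => /eqP eAB.
  by apply/eqP; rewrite eA eB eq_mulVg1.
apply: coset_id; apply/scalarsP=> P; rewrite gl_actM.
have /permP/(_ P) := exy; rewrite !permE eA eB !pgl_act_coset => <-.
by rewrite -gl_actM mulVg gl_act1.
Qed.

Definition derangement_graph : rel PGL2 :=
  fun g h => derangement (pgl_perm (h^-1 * g)).

Lemma derangement_graph_irrefl : irreflexive derangement_graph.
Proof.
have e0 : (const_mx 1%R : 'cV[F]_2) != 0%R.
  by apply/eqP=> /matrixP/(_ 0%R 0%R); rewrite !mxE => /eqP; rewrite oner_eq0.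
move=> g; apply/forallP=> /(_ (line e0)).
by rewrite mulVg permE pgl_act1 eqxx.
Qed.

Lemma derangement_graph_sym : symmetric derangement_graph.
Proof.
suffices imp g h : derangement_graph g h -> derangement_graph h g.
  by move=> g h; apply/idP/idP; apply: imp.
move/forallP=> dgh; apply/forallP=> P; apply: contra (dgh P) => /eqP.
rewrite !permE => e; rewrite -{1}e -pgl_actM -mulgA mulKVg mulVg.
by rewrite pgl_act1.
Qed.

Definition is_field_aut (a : {perm F}) : bool :=
  [&& a 1%R == 1%R,
      [forall x, forall y, a (x + y)%R == (a x + a y)%R]
    & [forall x, forall y, a (x * y)%R == (a x * a y)%R]].

Definition field_aut := {a : {perm F} | is_field_aut a}.
HB.instance Definition _ := SubFinite.on field_aut.

Definition field_aut_fun (a : field_aut) : F -> F := \val a.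

Fact field_aut_is_zmod_morphism a : zmod_morphism (field_aut_fun a).
Proof.
have /and3P[_ /forallP aD _] := valP a => x y.
apply: (addIr (field_aut_fun a y)); rewrite subrK.
by have /forallP/(_ y)/eqP := aD (x - y)%R; rewrite subrK.
Qed.
Fact field_aut_is_monoid_morphism a : monoid_morphism (field_aut_fun a).
Proof.
have /and3P[/eqP a1 _ /forallP aM] := valP a; split=> // x y.
by have /forallP/(_ y)/eqP := aM x.
Qed.
HB.instance Definition _ a := GRing.isZmodMorphism.Build F F (field_aut_fun a)
  (field_aut_is_zmod_morphism a).
HB.instance Definition _ a := GRing.isMonoidMorphism.Build F F (field_aut_fun a)
  (field_aut_is_monoid_morphism a).

Fact field_aut_line_subproof (a : field_aut) (P : PG1) :
  map_mx (field_aut_fun a) (vpick (\val P)) != 0%R.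
Proof. by rewrite map_mx_eq0 vpick_PG1. Qed.
(* The line spanned by the coordinatewise image of a spanning vector of P; by *)
(* [mem_field_aut_act] this is the coordinatewise image of the line P.        *)
Definition field_aut_act (a : field_aut) (P : PG1) : PG1 :=
  line (field_aut_line_subproof a P).

Lemma mem_field_aut_act a P v :
  (map_mx (field_aut_fun a) v \in \val (field_aut_act a P)) = (v \in \val P).
Proof.
have eP : \val P = <[vpick (\val P)]>%VS.
  by apply: PG1_vline; rewrite ?memv_pick ?vpick_PG1.
rewrite [in RHS]eP /=; apply/vlineP/vlineP=> [] [c].
  have /(congr1 (\val a)) := permKV (\val a) c.
  move/perm_inj => {1}<-; rewrite -[X in (X *: _)%R]/(field_aut_fun a _).
  by rewrite -map_mxZ => /map_mx_inj ->; eexists.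
by move->; rewrite map_mxZ; eexists.
Qed.

Lemma field_aut_act_line a v (v0 : v != 0%R) :
  \val (field_aut_act a (line v0)) = <[map_mx (field_aut_fun a) v]>%VS.
Proof.
apply: PG1_vline; last by rewrite map_mx_eq0.
by rewrite mem_field_aut_act memv_line.
Qed.

Lemma field_aut_act_inj a : injective (field_aut_act a).
Proof.
move=> P Q eaPQ; apply/val_inj/vspaceP=> v.
by rewrite -(mem_field_aut_act a P) eaPQ mem_field_aut_act.
Qed.

Definition field_aut_perm (a : field_aut) : {perm PG1} :=
  perm (@field_aut_act_inj a).

Fact gl_field_aut_subproof (a : field_aut) (A : {'GL_2[F]}) :
  map_mx (field_aut_fun a) (GLval A) \is a GRing.unit.
Proof. by rewrite -[_ \is a _]/(_ \in unitmx) map_unitmx GL_unitmx. Qed.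
Definition gl_field_aut (a : field_aut) (A : {'GL_2[F]}) : {'GL_2[F]} :=
  FinRing.unit _ (gl_field_aut_subproof a A).

Lemma pgl_perm_field_autJ a (A : {'GL_2[F]}) :
  pgl_perm (coset scalars (gl_field_aut a A))
    = pgl_perm (coset scalars A) ^ field_aut_perm a.
Proof.
apply/permP=> P; rewrite conjgE !permM.
set Q := (field_aut_perm a)^-1 P.
have -> : P = field_aut_perm a Q by rewrite permKV.
rewrite !permE !pgl_act_coset; have [v [v0 ->]] := PG1E Q.
have Av0 : ((GLval A : 'M[F]_2) *m v != 0)%R.
  apply: contraNneq v0 => /(congr1 (mulmx (invmx (GLval A)))).
  by rewrite mulKmx ?GL_unitmx // mulmx0 => ->.
have -> : gl_act A (line v0) = line Av0 by apply: val_inj; rewrite gl_act_line.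
have av0 : map_mx (field_aut_fun a) v != 0%R by rewrite map_mx_eq0.
have -> : field_aut_act a (line v0) = line av0.
  by apply: val_inj; rewrite field_aut_act_line.
by apply: val_inj; rewrite gl_act_line field_aut_act_line map_mxM.
Qed.

Lemma pgl_perm_codomJ (a : field_aut) (x : PGL2) :
  pgl_perm x ^ field_aut_perm a \in codom pgl_perm.
Proof.
by have [A ->] := PGL2P x; rewrite -pgl_perm_field_autJ; apply: codom_f.
Qed.

(* The element of PGL_2(F) that acts on the projective line as the conjugate  *)
(* of x by the field automorphism a.                                          *)
Definition gamma_fun (a : field_aut) (x : PGL2) : PGL2 :=
  iinv (pgl_perm_codomJ a x).

Lemma pgl_perm_gamma_fun a x :
  pgl_perm (gamma_fun a x) = pgl_perm x ^ field_aut_perm a.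
Proof. exact: f_iinv. Qed.

Lemma gamma_fun_inj a : injective (gamma_fun a).
Proof.
move=> x y /(congr1 pgl_perm); rewrite !pgl_perm_gamma_fun.
by move/conjg_inj/pgl_perm_inj.
Qed.

Definition gamma (a : field_aut) : {perm PGL2} := perm (@gamma_fun_inj a).

Lemma gamma_coset a (A : {'GL_2[F]}) :
  gamma a (coset scalars A) = coset scalars (gl_field_aut a A).
Proof.
apply: pgl_perm_inj.
by rewrite permE pgl_perm_gamma_fun pgl_perm_field_autJ.
Qed.

Definition gamma_Aut : {set {perm PGL2}} := [set gamma a | a : field_aut].

Lemma gamma_Aut_group_set : group_set gamma_Aut.
Proof.
apply/group_setP; split.
  have aut1 : is_field_aut 1.
    rewrite /is_field_aut !perm1 eqxx /=.
    by apply/andP; split; do 2![apply/forallP=> ?]; rewrite !perm1.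
  apply/imsetP; exists (exist _ (1 : {perm F}) aut1 : field_aut) => //.
  apply/permP=> x; have [A ->] := PGL2P x; rewrite perm1 gamma_coset.
  congr coset; apply/val_inj/matrixP=> i j.
  by rewrite /= mxE /field_aut_fun /= perm1.
move=> _ _ /imsetP[a _ ->] /imsetP[b _ ->].
have autM : is_field_aut (\val a * \val b).
  have /and3P[/eqP a1 /forallP aD /forallP aM] := valP a.
  have /and3P[/eqP b1 /forallP bD /forallP bM] := valP b.
  apply/and3P; split; first by rewrite permM a1 b1.
    apply/forallP=> x; apply/forallP=> y; rewrite !permM.
    by rewrite (eqP (forallP (aD x) y)) (eqP (forallP (bD _) _)).
  apply/forallP=> x; apply/forallP=> y; rewrite !permM.
  by rewrite (eqP (forallP (aM x) y)) (eqP (forallP (bM _) _)).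
apply/imsetP; exists (exist _ (\val a * \val b : {perm F}) autM : field_aut) => //.
apply/permP=> x; have [A ->] := PGL2P x; rewrite permM !gamma_coset.
congr coset; apply/val_inj/matrixP=> i j.
by rewrite /= !mxE /field_aut_fun /= permM.
Qed.
Canonical gamma_Aut_group := Group gamma_Aut_group_set.

End ProjectiveLine.

Arguments PGL2 F : clear implicits.
Arguments gamma_Aut F : clear implicits.
Arguments derangement_graph F : clear implicits.

(* Main.v *)
(** Write x ~ y when x^-1 y is a derangement, and let agree x y be the number of
    points at which x and y agree, so that x ~ y iff agree x y = 0.

    A nontrivial g with a fixed point is conjugate to t |-> l t + 1, and has one
    fixed point if l = 1 and two otherwise.  Since W is a derangement iff its
    characteristic polynomial has no root, the number of common neighbours of x
    and y with y^-1 x conjugate to t |-> l t + 1 is, up to the factor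
    #|scalars F|, the number of 2x2 matrices W such that neither W nor
    [l, 1; 0, 1] W has an eigenvalue.  With I(d) the number of s such that
    u^2 - s u + d has no root and q = #|F|, this is q * sum_d I(d) (I(d) - 1) if
    l = 1 and (q - 1) * sum_d I(d) I(l d) otherwise; the first is always strictly
    smaller than the second.  Hence automorphisms of the graph preserve agree.

    Let T(x, y, z) be the number of points at which x, y and z agree.  In a
    sharply 3-transitive group of degree n, the sum over w of
    agree w x * agree w y * agree w z is n^2 T(x, y, z) plus a function of
    agree x y, agree x z and agree y z, so T is preserved as well.  If x and y
    agree only at a, then T(x, y, z) = 1 iff z a = x a; so automorphisms permute
    the sets {z | z a = b}.  The incidences between these sets show that an
    automorphism s with s 1 = 1 satisfies s x (t a) = t (x a) for some permutation
    t of the points, after possibly composing s with inversion.  Then t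
    normalises PGL2 and, when it fixes oo, 0 and 1, is a field automorphism. *)

Require Import Defs.
From HB Require Import structures.
From mathcomp Require Import all_boot all_order all_algebra all_fingroup.
From mathcomp Require Import ring zify.

Set Implicit Arguments.
Unset Strict Implicit.
Unset Printing Implicit Defensive.

Import Order.TTheory GRing.Theory.

(** * Root-free quadratic polynomials over a finite field *)

Section RootFreeQuadratics.

Variable F : finFieldType.
Implicit Types a b c d s t u : F.

Local Open Scope ring_scope.

Definition quad_root s d u := u ^+ 2 - s * u + d == 0.
Definition root_free s d := [forall u, ~~ quad_root s d u].
Definition n_root_free d := #|[set s | root_free s d]|.
Definition n_sqrt d := #|[set u : F | u ^+ 2 == d]|.

Local Open Scope nat_scope.

Let q := #|F|.

Lemma card_set_sum (T : finType) (P : pred T) : #|[set x | P x]| = \sum_x P x.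
Proof.
by rewrite -sum1_card big_mkcond; apply: eq_bigr => x _; rewrite inE; case: P.
Qed.

Lemma quad_rootE s d u0 u : quad_root s d u0 ->
  quad_root s d u = (u == u0) || (u == s - u0)%R.
Proof.
rewrite /quad_root => /eqP r0.
have -> : (u ^+ 2 - s * u + d = (u - u0) * (u - (s - u0)))%R.
  by rewrite -[LHS]subr0 -r0; ring.
by rewrite mulf_eq0 !subr_eq0.
Qed.

(** The roots multiply to [d], so a root [u] is double exactly when [u ^+ 2 == d]. The weight thus
    counts roots with multiplicity, giving two or none. *)
Lemma sum_quad_root s d : d != 0%R ->
  \sum_u quad_root s d u * (1 + (u ^+ 2 == d)%R) = 2 * ~~ root_free s d.
Proof.
move=> d0; have [/forallP rf | /forallPn[u0 /negPn r0]] := boolP (root_free s d).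
  by rewrite big1 // => u _; rewrite (negPf (rf u)).
under eq_bigr => u _ do rewrite (quad_rootE u r0).
pose u1 := (s - u0)%R.
have def_d : d = (u0 * u1)%R.
  by move/eqP: r0 => r0; rewrite /u1 -[LHS]subr0 -r0; ring.
move: d0; rewrite def_d mulf_eq0 negb_or => /andP[nu0 nu1]; rewrite -/u1.
have [e|ne] := eqVneq u0 u1.
  rewrite (bigD1 u0) //= big1 => [|u nu]; last by rewrite -e (negPf nu).
  by rewrite -e eqxx expr2 eqxx.
rewrite (bigD1 u0) //= (bigD1 u1) 1?eq_sym //= big1 => [|u /andP[/negPf-> /negPf->]] //.
rewrite !eqxx orbT !expr2 /= (inj_eq (mulfI nu0)) (inj_eq (mulIf nu1)).
by rewrite [u1 == _]eq_sym (negPf ne).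
Qed.

Lemma sum_neq0 : \sum_(u : F | u != 0%R) 1 = q - 1.
Proof.
rewrite /q subn1 -(cardC1 (0%R : F)) -sum1_card.
by apply: eq_bigl => u; rewrite !inE.
Qed.

(** Double counting of pairs [(s, u)] with [u] a root, with multiplicity: each nonzero [u] is a root
    for the single value [s = u + d / u], while each [s] that is not root-free contributes two. *)
Lemma n_root_freeE d : d != 0%R -> 2 * n_root_free d + n_sqrt d = q + 1.
Proof.
move=> d0.
have: \sum_s \sum_u quad_root s d u * (1 + (u ^+ 2 == d)%R) = (q - 1) + n_sqrt d.
  rewrite exchange_big /= (bigD1 0%R) //= big1 => [|s _]; last first.
    by rewrite /quad_root expr0n mulr0 subr0 add0r (negPf d0).
  rewrite /n_sqrt card_set_sum [in RHS](bigD1 0%R) //= expr0n eq_sym (negPf d0) !add0n.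
  rewrite -sum_neq0.
  rewrite -big_split /=; apply: eq_bigr => u nu.
  rewrite -big_distrl /= (bigD1 (u + d / u)%R) //= big1 => [|s ns].
    rewrite /quad_root (_ : _ == _) ?mul1n //.
    by apply/eqP; field.
  rewrite /quad_root; case: eqP => // r0; case/eqP: ns.
  apply: (mulIf nu); rewrite mulrDl divfK //.
  by rewrite -[LHS]addr0 -r0; ring.
under eq_bigr => s _ do rewrite sum_quad_root //.
rewrite -big_distrr /= -card_set_sum.
have -> : #|[set s | ~~ root_free s d]| = q - n_root_free d.
  by rewrite /q -(cardsC [set s | root_free s d]) addKn; apply: eq_card => s; rewrite !inE.
have : n_root_free d <= q by apply: max_card.
have : 0 < q by apply/card_gt0P; exists 0%R.
by lia.
Qed.

Lemma n_root_free0 : n_root_free 0%R = 0.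
Proof.
apply/eqP; rewrite cards_eq0; apply/eqP/setP=> s; rewrite !inE.
by apply/forallPn; exists 0%R; rewrite /quad_root expr0n mulr0 subr0 addr0 eqxx.
Qed.

Lemma n_sqrt_le2 d : n_sqrt d <= 2.
Proof.
rewrite /n_sqrt; have [->|[u]] := set_0Vmem [set u : F | (u ^+ 2 == d)%R].
  by rewrite cards0.
rewrite inE => /eqP<-; apply: leq_trans (_ : #|[set u; (- u)%R]| <= 2).
  by apply/subset_leq_card/subsetP=> v; rewrite !inE eqf_sqr.
by rewrite cards2; case: (_ != _).
Qed.

Lemma sum_n_sqrt : \sum_(d | d != 0%R) n_sqrt d = q - 1.
Proof.
have: \sum_d n_sqrt d = q.
  under eq_bigr => d _ do rewrite /n_sqrt card_set_sum.
  rewrite exchange_big /= /q -sum1_card; apply: eq_bigr => u _.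
  rewrite (bigD1 (u ^+ 2)%R) //= eqxx big1 // => d nd.
  by rewrite eq_sym (negPf nd).
rewrite (bigD1 0%R) //= => <-.
have -> : n_sqrt 0%R = 1; last by rewrite addKn.
by rewrite /n_sqrt -[RHS](cards1 (0%R : F)); apply: eq_card => u; rewrite !inE sqrf_eq0.
Qed.

(* The number of W = [a, b; c, d] such that neither W nor [l, 1; 0, 1] W has an
   eigenvalue. *)
Definition n_root_free_pair (l : F) :=
  \sum_c \sum_d \sum_a \sum_b
    (root_free (a + d)%R (a * d - b * c)%R &&
     root_free (l * a + c + d)%R (l * (a * d - b * c))%R).

(** If [c = 0] then [a] is an eigenvalue and nothing is counted. Otherwise [a] and [b] can be traded
    for the trace [s = a + d] and the determinant [t = a * d - b * c]. *)
Lemma n_root_free_pairE l : n_root_free_pair l =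
  \sum_(c | c != 0%R) \sum_t \sum_s \sum_d
    (root_free s t && root_free (l * (s - d) + c + d)%R (l * t)%R).
Proof.
rewrite /n_root_free_pair (bigID (fun c => c == 0%R)) /= big1 ?add0n => [|c /eqP->].
  apply: eq_bigr => c nc.
  transitivity (\sum_d \sum_s \sum_t
    (root_free s t && root_free (l * (s - d) + c + d)%R (l * t)%R)).
    apply: eq_bigr => d _; rewrite [RHS](reindex_inj (addIr d)) /=.
    apply: eq_bigr => a _; rewrite addrK [RHS](reindex (fun b => a * d - b * c)%R) //=.
    exists (fun t => (a * d - t) / c)%R => t _ /=; first by rewrite opprB addrC subrK mulfK.
    by rewrite divfK // opprB addrC subrK.
  under eq_bigr => d _ do rewrite exchange_big /=.
  by rewrite exchange_big /=; apply: eq_bigr => t _; apply: exchange_big.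
rewrite big1 // => d _; rewrite big1 // => a _; rewrite big1 // => b _.
rewrite (_ : root_free _ _ = false) //; apply/negbTE/forallPn; exists a.
by rewrite negbK /quad_root; apply/eqP; ring.
Qed.

(** For [l = 1] the second trace is [s + c], free of [d], whence the factor [q]. The summand added
    on the left is the missing term [c = 0], which makes [s + c] range over all of [F]. *)
Lemma n_root_free_pair_parabolic :
  n_root_free_pair 1%R + q * \sum_d n_root_free d =
  q * \sum_d n_root_free d * n_root_free d.
Proof.
rewrite n_root_free_pairE exchange_big /= !big_distrr -big_split /=.
apply: eq_bigr => t _.
transitivity (q * \sum_c \sum_s (root_free s t && root_free (s + c)%R t)).
  rewrite [in RHS](bigD1 0%R) //= mulnDr addnC; congr addn.
    congr muln; rewrite /n_root_free card_set_sum; apply: eq_bigr => s _.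
    by rewrite addr0 andbb.
  rewrite big_distrr; apply: eq_bigr => c _; rewrite big_distrr.
  apply: eq_bigr => s _; under eq_bigr => d _ do rewrite !mul1r addrAC subrK.
  by rewrite sum_nat_const.
congr muln; rewrite exchange_big /= {1}/n_root_free card_set_sum big_distrl /=.
apply: eq_bigr => s _; rewrite /n_root_free card_set_sum big_distrr /=.
rewrite [RHS](reindex_inj (addrI s)) /=; apply: eq_bigr => c _.
by rewrite mulnb.
Qed.

(** For [l != 1] the second trace is a bijective affine function of [d], so the two traces vary
    independently and [c] contributes the factor [q - 1]. *)
Lemma n_root_free_pair_hyperbolic l : l != 1%R ->
  n_root_free_pair l = (q - 1) * \sum_d n_root_free d * n_root_free (l * d)%R.
Proof.
move=> l1; rewrite n_root_free_pairE.
rewrite -sum_neq0.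
rewrite big_distrl /=; apply: eq_bigr => c _; rewrite mul1n.
apply: eq_bigr => t _; rewrite {1}/n_root_free card_set_sum big_distrl /=.
apply: eq_bigr => s _; rewrite /n_root_free card_set_sum big_distrr /=.
rewrite [RHS](reindex (fun d => l * (s - d) + c + d)%R) /=.
  by apply: eq_bigr => d _; rewrite mulnb.
have l1' : (1 - l != 0)%R by rewrite subr_eq0 eq_sym.
by exists (fun v => (v - l * s - c) / (1 - l))%R => d _ /=; field.
Qed.

Lemma n_root_free_pair_lt l : l != 0%R -> l != 1%R ->
  n_root_free_pair 1%R < n_root_free_pair l.
Proof.
move=> l0 l1; have := n_root_free_pair_parabolic.
rewrite (n_root_free_pair_hyperbolic l1).
have drop0 (f : F -> nat) : f 0%R = 0 -> \sum_d f d = \sum_(d | d != 0%R) f d.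
  by move=> f0; rewrite (bigD1 0%R) //= f0.
rewrite !drop0 ?mulr0 ?n_root_free0 ?muln0 //.
set A := \sum_(d | _) _; set B := \sum_(d | _) _; set C := \sum_(d | _) _.
set P := n_root_free_pair 1%R.
have q2 : 1 < q.
  by rewrite /q (cardD1 0%R) (cardD1 1%R) !inE oner_eq0.
have sum1 := sum_neq0.
have sumr' : \sum_(d | d != 0%R) n_sqrt (l * d)%R = q - 1.
  rewrite -sum_n_sqrt [RHS](reindex_inj (mulfI l0)) /=.
  by apply: eq_bigl => d; rewrite mulf_eq0 negb_or l0.
have [w def_q] : exists w, q = w.+1 by exists q.-1; rewrite prednK // ltnW.
have qE : q - 1 = w by rewrite def_q subn1.
rewrite qE in sum1 sumr' *.
(* With [r = n_sqrt d] one has [2 * n_root_free d = w + 2 - r]. The [w] terms [r] sum to [w], and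
   the bound holds term by term because [r ^ 2 <= 2 * r] for [r <= 2]. *)
have upper : 4 * B + 2 * w * w <= w * (w + 2) * w + 4 * A.
  rewrite -{2}qE -sum_n_sqrt -{4}sum1 /A /B !big_distrr -!big_split /=.
  apply: leq_sum => d nd; have := n_root_freeE nd; have := n_sqrt_le2 d.
  rewrite def_q; move: (n_root_free d) (n_sqrt d) => i r r2 e.
  have {e} def_w : w + 2 = 2 * i + r by lia.
  case: r r2 def_w => [|[|[|]]] // _ def_w.
  - case: i def_w => [|i] def_w; first by lia.
    have -> : w = 2 * i by lia.
    by nia.
  - case: i def_w => [|i] def_w; first by lia.
    have -> : w = 2 * i + 1 by lia.
    by nia.
  - have -> : w = 2 * i by lia.
    by nia.
(* Term by term, [4 * i * i' = (w + 2 - r) * (w + 2 - r')], and the product [r * r'] is dropped. *)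
have lower : (w + 2) * (w + 2) * w <= 4 * C + (w + 2) * w + (w + 2) * w.
  rewrite -{5}sumr' -{6}qE -sum_n_sqrt -{3}sum1 /C !big_distrr -!big_split /=.
  apply: leq_sum => d nd; have := n_root_freeE nd.
  have /n_root_freeE : (l * d != 0)%R by rewrite mulf_neq0.
  rewrite def_q.
  move: (n_root_free d) (n_sqrt d) (n_root_free _) (n_sqrt _) => i r i' r' e' e.
  by nia.
have upper' : 4 * B <= w * w * w + 4 * A by nia.
have lower' : w * w * (w + 2) <= 4 * C by nia.
(* The bounds give [4 * P <= (w + 1) * w ^ 3], whereas four times the right-hand side is at least
   [w ^ 3 * (w + 2)]. *)
rewrite def_q => eP; rewrite -(ltn_pmul2l (isT : 0 < 4)).
have ub : 4 * P <= w.+1 * (w * w * w) by nia.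
apply: leq_ltn_trans ub _; apply: leq_trans (_ : w * (w * w * (w + 2)) <= _).
  by nia.
by rewrite [leqRHS]mulnCA leq_mul2l lower' orbT.
Qed.

End RootFreeQuadratics.

(** * Sharply 3-transitive groups *)

Local Open Scope group_scope.

Lemma uniq3 (T : eqType) (a b c : T) :
  uniq [:: a; b; c] = [&& a != b, c != a & c != b].
Proof.
by rewrite /= !inE negb_or andbT -andbA (eq_sym a c) (eq_sym b c).
Qed.

Section SharplyThreeTransitive.

Variables (gT : finGroupType) (Omega : finType) (act : gT -> Omega -> Omega).
Hypothesis actM : forall x y a, act (x * y) a = act x (act y a).
Hypothesis act1 : forall a, act 1 a = a.
Hypothesis act_trans3 : forall a b c a' b' c',
  uniq [:: a; b; c] -> uniq [:: a'; b'; c'] ->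
  exists x, [/\ act x a = a', act x b = b' & act x c = c'].
Hypothesis act_free3 : forall x a b c, uniq [:: a; b; c] ->
  act x a = a -> act x b = b -> act x c = c -> x = 1.
Hypothesis card_Omega : 2 < #|Omega|.

Implicit Types (x y z w : gT) (a b c d e : Omega).

Lemma act_invK x : cancel (act x) (act x^-1).
Proof. by move=> a; rewrite -actM mulVg act1. Qed.

Lemma act_invVK x : cancel (act x^-1) (act x).
Proof. by move=> a; rewrite -actM mulgV act1. Qed.

Lemma act_injective x : injective (act x). Proof. exact: can_inj (act_invK x). Qed.

Lemma third_point a b : exists c, (c != a) && (c != b).
Proof.
have : 0 < #|~: [set a; b]|.
  rewrite cardsCs setCK subn_gt0 cards2.
  by apply: leq_ltn_trans card_Omega; case: (a != b).
by case/card_gt0P=> c; rewrite !inE negb_or; exists c.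
Qed.

Lemma act_trans2 a b a' b' : a != b -> a' != b' ->
  exists x, act x a = a' /\ act x b = b'.
Proof.
move=> nab nab'; have [c /andP[nca ncb]] := third_point a b.
have [c' /andP[nca' ncb']] := third_point a' b'.
have [||x [xa xb _]] := @act_trans3 a b c a' b' c'; last by exists x.
  by rewrite uniq3 nab nca ncb.
by rewrite uniq3 nab' nca' ncb'.
Qed.

Definition agree x y := #|[set a | act x a == act y a]|.
Definition agree3 x y z :=
  #|[set a | (act x a == act y a) && (act x a == act z a)]|.

(** * Elements through prescribed cells and the triple agreement sum *)

Section Counting.

Local Open Scope ring_scope.

Let n : int := #|Omega|%:Z.
Let D (a b : Omega) : int := (a == b)%:R.

Let sumD c (h : Omega -> int) : \sum_a D a c * h a = h c.
Proof.
rewrite (bigD1 c) //= /D eqxx mul1r big1 ?addr0 // => a /negPf->.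
by rewrite mul0r.
Qed.

Let sumD1 c : \sum_a D a c = 1.
Proof. by rewrite -[RHS](sumD c (fun=> 1)); apply: eq_bigr => a _; rewrite mulr1. Qed.

Let sumD1' c : \sum_a D c a = 1.
Proof. by rewrite -[RHS](sumD1 c); apply: eq_bigr => a _; rewrite /D eq_sym. Qed.

Let sum1 : \sum_(a : Omega) 1 = n.
Proof. by rewrite sumr_const /n natz. Qed.

Let agreeE x y : (agree x y)%:Z = \sum_a D (act x a) (act y a).
Proof.
rewrite /agree -sum1_card -natz big_mkcond /= natr_sum.
by apply: eq_bigr => a _; rewrite inE /D; case: eqP.
Qed.

Let agree3E x y z :
  (agree3 x y z)%:Z = \sum_a D (act x a) (act y a) * D (act x a) (act z a).
Proof.
rewrite /agree3 -sum1_card -natz big_mkcond /= natr_sum.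
by apply: eq_bigr => a _; rewrite inE /D; do 2![case: eqP].
Qed.

Let N3 a a' c c' e e' : int :=
  \sum_w D (act w a) a' * D (act w c) c' * D (act w e) e'.

(** Distinct targets are reached by exactly one element. Since [a' != c'], the only possible
    coincidences are [e' = a'] and [e' = c'], and injectivity then leaves no element. *)
Let N3_distinct a a' c c' e e' : uniq [:: a; c; e] -> a' != c' ->
  N3 a a' c c' e e' = 1 - D e' a' - D e' c'.
Proof.
move=> u u'; have [->|nea] := eqVneq e' a'.
  rewrite /D eqxx (negPf u') /N3 big1 ?subrr ?subr0 // => w _; rewrite /D.
  case: (eqVneq _ a') => [<-|]; last by rewrite !mul0r.
  move: u; rewrite uniq3 (inj_eq (@act_injective w)) => /and3P[_ /negPf-> _].
  by rewrite mulr0.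
have [->|nec] := eqVneq e' c'.
  rewrite /D eqxx [c' == a']eq_sym (negPf u') /N3 big1 ?subrr ?subr0 // => w _.
  rewrite /D; case: (eqVneq (act w c) c') => [<-|]; last by rewrite mulr0 mul0r.
  move: u; rewrite uniq3 (inj_eq (@act_injective w)) => /and3P[_ _ /negPf->].
  by rewrite mulr0.
have [|x [xa xc xe]] := @act_trans3 a c e a' c' e' u.
  by rewrite uniq3 u' nea nec.
rewrite /D (negPf nea) (negPf nec) !subr0 /N3 (bigD1 x) //= big1 => [|w nwx].
  by rewrite xa xc xe /D !eqxx !mulr1 addr0.
rewrite /D; case: eqP => [wa|_]; last by rewrite !mul0r.
case: eqP => [wc|_]; last by rewrite mulr0 mul0r.
case: eqP => [we|_]; last by rewrite mulr0.
case/eqP: nwx; apply/eqP; rewrite eq_sym eq_mulVg1; apply/eqP.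
by apply: (@act_free3 _ a c e) => //; rewrite actM ?wa ?wc ?we -?xa -?xc -?xe act_invK.
Qed.

(** Summing [N3] over the target [e'] of a third point counts each [w] once; [N1] is obtained from
    [N2] in the same way. *)
Let N2 a a' c c' : a != c -> a' != c' ->
  \sum_w D (act w a) a' * D (act w c) c' = n - 2.
Proof.
move=> nac nac'; have [e /andP[nea nec]] := third_point a c.
transitivity (\sum_e' N3 a a' c c' e e').
  rewrite exchange_big /=; apply: eq_bigr => w _.
  by rewrite -mulr_sumr sumD1' mulr1.
under eq_bigr => e' _.
  rewrite N3_distinct //; last by rewrite uniq3 nac nea nec.
  over.
by rewrite !big_split /= !sumrN !sumD1 sum1; rewrite /=; ring.
Qed.

Let N1 a a' : \sum_w D (act w a) a' = (n - 1) * (n - 2).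
Proof.
have [c /andP[nca _]] := third_point a a.
transitivity (\sum_c' \sum_w D (act w a) a' * D (act w c) c').
  rewrite exchange_big /=; apply: eq_bigr => w _.
  by rewrite -mulr_sumr sumD1' mulr1.
transitivity (\sum_c' (n - 2) * (1 - D c' a')).
  apply: eq_bigr => c' _; have [->|nac'] := eqVneq c' a'.
    rewrite /D eqxx subrr mulr0 big1 // => w _.
    case: (eqVneq (act w a) _) => [<-|]; last by rewrite mul0r.
    by rewrite (inj_eq (@act_injective w)) (negPf nca).
  by rewrite /D (negPf nac') subr0 mulr1 N2 // eq_sym.
by rewrite -mulr_sumr big_split /= sumrN sumD1 sum1; rewrite /=; ring.
Qed.
Let D_same w a a' c' : D (act w a) a' * D (act w a) c' = D a' c' * D (act w a) a'.
Proof.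
rewrite /D; case: eqP => [->|]; first by rewrite mul1r mulr1.
by rewrite mul0r mulr0.
Qed.

(** One expression for three regimes: a repeated cell, two compatible cells, and two cells sharing
    exactly one coordinate, through which no element passes. *)
Let N2E a a' c c' : \sum_w D (act w a) a' * D (act w c) c' =
  (n - 2) * (D a c * D a' c' * (n - 1) + (1 - D a c) * (1 - D a' c')).
Proof.
have [<-|nac] := eqVneq a c.
  under eq_bigr do rewrite D_same.
  by rewrite -mulr_sumr N1 /D eqxx; rewrite /=; ring.
have [<-|nac'] := eqVneq a' c'; last first.
  by rewrite N2 // /D (negPf nac) (negPf nac') /=; ring.
rewrite /D eqxx (negPf nac) big1 => [|w _]; first by rewrite /=; ring.
case: (eqVneq (act w a) _) => [<-|]; last by rewrite mul0r.
by rewrite (inj_eq (@act_injective w)) eq_sym (negPf nac) mulr0.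
Qed.

(* The coefficients are the Moebius inversion, over pairs of partitions of the
   three row indices and of the three column indices, of the number of elements
   through three cells with a given coincidence pattern.  Only the leading term
   survives as a genuinely ternary quantity once summed over x, y and z. *)
Let N3E a a' c c' e e' : N3 a a' c c' e e' =
  1 - (D a c + D c e + D a e + D a' c' + D c' e' + D a' e')
  + 2 * (D a c * D c e + D a' c' * D c' e')
  + (D a c * D c' e' + D a c * D a' e' + D c e * D a' c' + D c e * D a' e'
     + D a e * D a' c' + D a e * D c' e')
  + (n - 1) * (D a c * D a' c' + D c e * D c' e' + D a e * D a' e')
  - n * ((D a c + D c e + D a e) * (D a' c' * D c' e')
         + (D a' c' + D c' e' + D a' e') * (D a c * D c e))
  + n ^+ 2 * (D a c * D c e * (D a' c' * D c' e')).
Proof.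
have [<-|nac] := eqVneq a c.
  transitivity (D a' c' * \sum_w D (act w a) a' * D (act w e) e').
    rewrite mulr_sumr; apply: eq_bigr => w _.
    by rewrite D_same mulrA.
  rewrite N2E /D !eqxx; case: (eqVneq a' c') => [<-|nac']; last first.
    case: (eqVneq c' e') => [<-|_]; last by case: (a == e); case: (a' == e'); rewrite /=; ring.
    by rewrite (negPf nac'); case: (a == e); rewrite /=; ring.
  by case: (a == e); case: (a' == e'); rewrite /=; ring.
have [<-|nac'] := eqVneq a' c'.
  rewrite /N3 big1 => [|w _]; last first.
    rewrite /D; case: (eqVneq (act w a) _) => [<-|]; last by rewrite !mul0r.
    by rewrite (inj_eq (@act_injective w)) eq_sym (negPf nac) mulr0 mul0r.
  rewrite /D eqxx (negPf nac); case: (eqVneq a e) => [<-|_].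
    by rewrite eq_sym (negPf nac); case: (a' == e'); rewrite /=; ring.
  by case: (c == e); case: (a' == e'); rewrite /=; ring.
have [<-|nae] := eqVneq a e.
  transitivity (D a' e' * \sum_w D (act w a) a' * D (act w c) c').
    rewrite mulr_sumr; apply: eq_bigr => w _.
    by rewrite mulrAC D_same mulrA.
  rewrite N2E /D eqxx (negPf nac) (negPf nac') [c == a]eq_sym (negPf nac).
  case: (eqVneq a' e') => [<-|_]; last by case: (c' == e'); rewrite /=; ring.
  by rewrite eq_sym (negPf nac'); rewrite /=; ring.
have [<-|nce] := eqVneq c e.
  transitivity (D c' e' * \sum_w D (act w a) a' * D (act w c) c').
    rewrite mulr_sumr; apply: eq_bigr => w _.
    by rewrite -mulrA D_same mulrCA.
  rewrite N2E /D eqxx (negPf nac) (negPf nac').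
  case: (eqVneq c' e') => [<-|_]; last by case: (a' == e'); rewrite /=; ring.
  by rewrite (negPf nac'); rewrite /=; ring.
rewrite N3_distinct ?uniq3 ?nac // 1?eq_sym ?nae 1?eq_sym ?nce //.
rewrite /D (negPf nac) (negPf nac') (negPf nae) (negPf nce).
rewrite [e' == a']eq_sym [e' == c']eq_sym; case: (eqVneq a' e') => [<-|_].
  by rewrite eq_sym (negPf nac'); rewrite /=; ring.
by case: (c' == e'); rewrite /=; ring.
Qed.

(** Expanding each agreement as a sum over points and exchanging sums turns the left side into a sum
    of [N3] over [a], [c], [e]; then [N3E] applies. *)
Lemma sum_agree_agree_agree x y z :
  \sum_w (agree w x)%:Z * (agree w y)%:Z * (agree w z)%:Z =
  n ^+ 3 - 6 * n ^+ 2 + 10 * n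
  + n * (n - 3) * ((agree x y)%:Z + (agree x z)%:Z + (agree y z)%:Z)
  + n ^+ 2 * (agree3 x y z)%:Z.
Proof.
transitivity (\sum_a \sum_c \sum_e N3 a (act x a) c (act y c) e (act z e)).
  under eq_bigr => w _ do rewrite !agreeE big_distrlr /= mulr_suml.
  rewrite exchange_big /=; apply: eq_bigr => a _.
  under eq_bigr => w _ do rewrite big_distrlr /=.
  rewrite exchange_big /=; apply: eq_bigr => c _.
  by rewrite exchange_big.
have sumC (k : int) : \sum_(a : Omega) k = n * k.
  by rewrite sumr_const -mulr_natl natz.
(* Solving each incidence for one of its variables puts every [D] in the form [D variable value], so
   that [sumD] collapses the sums over [e], then [c]. *)
pose iy a := act y^-1 (act x a); pose jz b := act z^-1 b.
pose yz a := act y^-1 (act z a).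
have Dyc a c : D (act x a) (act y c) = D c (iy a).
  by rewrite /D eq_sym (can2_eq (act_invK y) (act_invVK y)).
have Dze b e : D b (act z e) = D e (jz b).
  by rewrite /D eq_sym (can2_eq (act_invK z) (act_invVK z)).
have Dyz a c : D a (jz (act y c)) = D c (yz a).
  by rewrite -Dze /D (can2_eq (act_invK y) (act_invVK y)).
have Ds a c : D a c = D c a by rewrite /D eq_sym.
have sum_e a c : \sum_e N3 a (act x a) c (act y c) e (act z e) =
    (n - 4) + D c a * ((4 - n) + (n * n - 3 * n) * D c (iy a)
      - n * D c (jz (act y c)) - n * D c (jz (act x a))
      + n * n * D c (iy a) * D c (jz (act y c)))
    + D c (iy a) * ((4 - n) - n * D c (jz (act y c)) - n * D c (yz a))
    + D c (jz (act x a)) + D c (yz a) + (n - 1) * D c (jz (act y c))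
    + (n - 1) * D a (jz (act x a)).
  transitivity (\sum_e (
     (1 - D c a - D c (iy a) + (n - 1) * D c a * D c (iy a))
     + D e c * (-1 + 2 * D c a + D c (iy a) + D e (jz (act x a))
          + (n - 1) * D e (jz (act y c)) - n * D c (iy a) * D e (jz (act y c))
          - n * D c a * (D c (iy a) + D e (jz (act y c)) + D e (jz (act x a)))
          + n * n * D c a * D c (iy a) * D e (jz (act y c)))
     + D e a * (-1 + D c (iy a) + D e (jz (act y c)) + (n - 1) * D e (jz (act x a))
          - n * D c (iy a) * D e (jz (act y c)))
     + D e (jz (act y c)) * (-1 + 2 * D c (iy a) + D c a - n * D c a * D c (iy a))
     + D e (jz (act x a)) * (-1 + D c a))).
    apply: eq_bigr => e _; rewrite N3E !Dyc !Dze [D a c]Ds [D c e]Ds [D a e]Ds.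
    by ring.
  rewrite !big_split /= !sumC !sumD (Dyz a c) /=; ring.
transitivity (\sum_a (n * n - 6 * n + 10 + n * (n - 3) * D a (iy a)
    + (n - 1) * (agree y z)%:Z
    + n * (n - 3) * D a (jz (act x a))
    - n * D a (jz (act y a)) - n * D (iy a) (jz (act y (iy a)))
    + n * n * (D a (iy a) * D a (jz (act x a))))).
  apply: eq_bigr => a _; under eq_bigr => c _ do rewrite sum_e.
  rewrite !big_split /= !sumC !sumD !sumD1 -!mulr_sumr.
have -> : \sum_c D c (jz (act y c)) = (agree y z)%:Z.
    by rewrite agreeE; apply: eq_bigr => c _; rewrite Dze.
  have -> : D (iy a) (yz a) = D a (jz (act x a)).
    by rewrite -Dze /D (inj_eq (@act_injective y^-1)).
  (* The first factor forces [act x a = act y a], so [y] may be replaced by [x] in the second. *)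
  have Exy : D a (iy a) * D a (jz (act y a)) = D a (iy a) * D a (jz (act x a)).
    rewrite -!Dze -Dyc /D; case: eqP => [->|_] //=; by rewrite !mul0r.
  by rewrite -[n * n * D a (iy a) * D a (jz (act y a))]mulrA Exy; ring.
rewrite !big_split /= !sumC !sumrN -!mulr_sumr.
have -> : \sum_a D a (iy a) = (agree x y)%:Z.
  by rewrite agreeE; apply: eq_bigr => a _; rewrite Dyc.
have -> : \sum_a D a (jz (act x a)) = (agree x z)%:Z.
  by rewrite agreeE; apply: eq_bigr => a _; rewrite Dze.
have Eyz : \sum_a D a (jz (act y a)) = (agree y z)%:Z.
  by rewrite agreeE; apply: eq_bigr => a _; rewrite Dze.
have -> : \sum_a D (iy a) (jz (act y (iy a))) = (agree y z)%:Z.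
  rewrite -Eyz [RHS](reindex_inj (h := iy)) // => a b /act_injective; exact: act_injective.
have -> : \sum_a D a (iy a) * D a (jz (act x a)) = (agree3 x y z)%:Z.
  by rewrite agree3E; apply: eq_bigr => a _; rewrite Dyc Dze.
by rewrite Eyz; ring.
Qed.

End Counting.

(** * Permutations of the group that preserve agreement *)

Section Automorphism.

Variable s : {perm gT}.
Hypothesis s_agree : forall x y, agree (s x) (s y) = agree x y.

Lemma agree3_perm x y z : agree3 (s x) (s y) (s z) = agree3 x y z.
Proof.
have := sum_agree_agree_agree (s x) (s y) (s z).
rewrite (reindex_inj (@perm_inj _ s)) /=.
under eq_bigr => w _ do rewrite !s_agree.
rewrite !s_agree sum_agree_agree_agree => /addrI/(mulfI _)E.
have n2 : (#|Omega|%:Z ^+ 2 != 0)%R by rewrite expf_neq0 //; lia.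
by have [] := E n2.
Qed.

Hypothesis act_parabolic :
  forall a, exists u, forall b, (act u b == b) = (b == a).

Lemma agree3_agree1 x y z a : (forall b, (act x b == act y b) = (b == a)) ->
  agree3 x y z = (act z a == act x a).
Proof.
move=> xy; rewrite /agree3 eq_sym; case: eqP => [xz | nxz].
  rewrite [X in #|pred_of_set X|](_ : _ = [set a]) ?cards1 //.
  by apply/setP=> b; rewrite !inE xy; case: eqP => // ->; rewrite xz eqxx.
apply/eqP; rewrite cards_eq0; apply/eqP/setP=> b; rewrite !inE xy.
by case: eqP => // ->; apply/eqP.
Qed.

(** The block of [z] with [act z a = b] is cut out by [agree3 x (x * u) z = 1], where [x] sends [a]
    to [b] and [u] fixes only [a]. The images of [x] and [x * u] again agree at a single point,
    which is [c], and [d] is their common value there. *)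
Lemma block_perm a b :
  exists c d, forall z, (act (s z) c == d) = (act z a == b).
Proof.
have [u fixu] := act_parabolic a.
have [a' /andP[na'a _]] := third_point a a.
have [b' /andP[nb'b _]] := third_point b b.
have [x [xa _]] : exists x, act x a = b /\ act x a' = b'.
  by apply: act_trans2; rewrite eq_sym.
have xy c : (act x c == act (x * u) c) = (c == a).
  by rewrite actM (inj_eq (@act_injective x)) eq_sym fixu.
have : agree (s x) (s (x * u)) = 1%N.
  rewrite s_agree /agree [X in #|pred_of_set X|](_ : _ = [set a]) ?cards1 //.
  by apply/setP=> c; rewrite !inE.
move/eqP/cards1P=> [c /setP sc]; exists c, (act (s x) c) => z.
have sxy d : (act (s x) d == act (s (x * u)) d) = (d == c).
  by have:= sc d; rewrite !inE.
have := agree3_perm x (x * u) z.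
rewrite (agree3_agree1 _ sxy) (agree3_agree1 _ xy) xa.
by do 2![case: eqP].
Qed.

Hypothesis s1 : s 1 = 1.

(** The identity lies in the block of [(a, a)] and is fixed by [s], so the corresponding block has
    [c = d]: point stabilisers correspond to point stabilisers. *)
Lemma stab_perm : exists2 t : Omega -> Omega, injective t &
  forall z a, (act (s z) (t a) == t a) = (act z a == a).
Proof.
have [a|t ts] := @fin_all_exists _ (fun=> Omega) (fun a c =>
  forall z, (act (s z) c == c) = (act z a == a)).
  have [c [d sz]] := block_perm a a; exists c => z; rewrite -sz.
  by have := sz 1; rewrite s1 !act1 eqxx => /eqP<-.
exists t => // a b tab; have [u fixu] := act_parabolic a.
by have := ts b u; rewrite -tab ts !fixu eqxx => /esym/eqP.
Qed.

Lemma agree_perm_act : exists2 t : Omega -> Omega, injective t &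
  (forall x a, act (s x) (t a) = t (act x a)) \/
  (forall x a, act (s x)^-1 (t a) = t (act x a)).
Proof.
have [t t_inj ts] := stab_perm.
(* [P] says that the block of [(a, b)] goes to that of [(t a, t b)]; [Q] says that source and target
   are interchanged, as under inversion. *)
pose P a b := forall z, (act (s z) (t a) == t b) = (act z a == b).
pose Q a b := forall z, (act (s z) (t b) == t a) = (act z a == b).
have surj w : exists z, w = s z by exists (s^-1 w); rewrite permKV.
have t_neq a b : a != b -> t a != t b by rewrite (inj_eq t_inj).
(* The block of [(a, b)] misses the stabilisers of [a] and of [b], so its image, the block of
   [(c, d)], misses those of [t a] and [t b]. By 2-transitivity this forces both [t a] and [t b]
   into [{c, d}]. *)
have PQ a b : a != b -> P a b \/ Q a b.
  move=> nab; have [c [d sz]] := block_perm a b.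
  have ncd : c != d by have := sz 1; rewrite s1 !act1 (negPf nab) => ->.
  have ta : (t a == c) || (t a == d).
    apply/negPn; rewrite negb_or; apply/negP=> /andP[nc nd].
    have [w [wa wc]] := act_trans2 nc nd; have [z def_w] := surj w.
    have /eqP za : act z a == a by rewrite -ts -def_w wa.
    by case/eqP: nab; rewrite -za; apply/eqP; rewrite -sz -def_w wc.
  have tb : (t b == c) || (t b == d).
    apply/negPn; rewrite negb_or; apply/negP=> /andP[nc nd].
    have [w [wb wc]] := act_trans2 nc nd; have [z def_w] := surj w.
    have /eqP za : act z a == b by rewrite -sz -def_w wc.
    have /eqP zb : act z b == b by rewrite -ts -def_w wb.
    by case/eqP: nab; apply: (@act_injective z); rewrite za zb.
  have ntab := t_neq _ _ nab.
  case/orP: ta tb ntab => [/eqP ac|/eqP ad] /orP[/eqP bc|/eqP bd] ntab.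
  - by rewrite ac bc eqxx in ntab.
  - by left=> z; rewrite ac bd sz.
  - by right=> z; rewrite ad bc sz.
  - by rewrite ad bd eqxx in ntab.
(* If [P a b] and [Q a c] held with [b != c], an element sending [t a] to [t b] and [t c] to [t a]
   would come from a [z] taking two values at [a]. [Pc] is the dual argument, with two points sent
   to [b]. *)
have Pr a b c : a != b -> a != c -> P a b -> P a c.
  move=> nab nac Pab; case: (PQ a c nac) => // Qac.
  have [<-//|nbc] := eqVneq b c.
  have [|w [wa wc]] := act_trans2 (t_neq _ _ nac) (a' := t b) (b' := t a).
    by rewrite eq_sym t_neq.
  have [z def_w] := surj w.
  have /eqP za : act z a == b by rewrite -Pab -def_w wa.
  by case/eqP: nbc; rewrite -za; apply/eqP; rewrite -Qac -def_w wc.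
have Pc a b c : a != b -> c != b -> P a b -> P c b.
  move=> nab ncb Pab; case: (PQ c b ncb) => // Qcb.
  have [<-//|nac] := eqVneq a c.
  have [|w [wa wb]] := act_trans2 (t_neq _ _ nab) (a' := t b) (b' := t c).
    by rewrite eq_sym t_neq.
  have [z def_w] := surj w.
  have /eqP za : act z a == b by rewrite -Pab -def_w wa.
  have /eqP zc : act z c == b by rewrite -Qcb -def_w wb.
  by case/eqP: nac; apply: (@act_injective z); rewrite za zc.
have Pall a0 b0 a b : a0 != b0 -> P a0 b0 -> a != b -> P a b.
  move=> nab0 P0 nab; have [eb|nb] := eqVneq a0 b; last first.
    exact: Pc nb nab (Pr _ _ _ nab0 nb P0).
  (* When [b = a0], the pair [(a0, b)] is degenerate, so the passage goes through [(c, b0)] and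
     [(c, b)]. *)
  have [c /andP[nca ncb]] := third_point a0 b0.
  rewrite -eb in nab *.
  exact: Pc nca nab (Pr _ _ _ ncb nca (Pc _ _ _ nab0 ncb P0)).
exists t => //.
(* A boolean form of [P], so that a finite search decides between the two alternatives. *)
pose Pb (p : Omega * Omega) := (p.1 != p.2) &&
  [forall z, (act (s z) (t p.1) == t p.2) == (act z p.1 == p.2)].
case: (pickP Pb) => [[a0 b0] /andP[/= nab0 /forallP P0] | noP].
  left=> x a; apply/eqP; have [xa|nxa] := eqVneq a (act x a); last first.
    by rewrite (Pall a0 b0) // => z; apply: (eqP (P0 z)).
  by rewrite -xa ts -xa.
right=> x a.
have sx b : act x a = b -> act (s x) (t b) = t a.
  move=> xab; apply/eqP; have [eab|nab] := eqVneq a b; first by rewrite eab ts -{1}eab xab.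
  case: (PQ a b nab) => [Pab | ->]; last exact/eqP.
  by case/negP: (negbT (noP (a, b))); rewrite /Pb /= nab; apply/forallP=> z; rewrite Pab.
by rewrite -(sx _ erefl) act_invK.
Qed.

End Automorphism.

End SharplyThreeTransitive.

(** * Coordinates on the projective line *)

Section ProjectiveCoordinates.

Variable F : finFieldType.
Implicit Types (t u : F) (P Q R : PG1 F) (x y z g : PGL2 F) (A : {'GL_2[F]}).

Local Open Scope ring_scope.

Definition mx2 (a b c d : F) : 'M[F]_2 := \matrix_(i, j)
  if i == 0 then if j == 0 then a else b else if j == 0 then c else d.

Definition cv2 (a b : F) : 'cV[F]_2 := \col_i if i == 0 then a else b.

Lemma cv2E (v : 'cV[F]_2) : v = cv2 (v 0 0) (v 1 0).
Proof.
apply/matrixP=> i j; rewrite !mxE [j]ord1.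
by case: (eqVneq i 0) => [->//|]; case: i => [[|[]]] // ? _; congr (v _ _); apply/val_inj.
Qed.

Lemma mx2E (M : 'M[F]_2) : M = mx2 (M 0 0) (M 0 1) (M 1 0) (M 1 1).
Proof.
apply/matrixP=> i j; rewrite !mxE.
by case: i j => [[|[]]] // ? [[|[]]] // ?; congr (M _ _); apply/val_inj.
Qed.

Lemma det_mx2 a b c d : \det (mx2 a b c d) = a * d - b * c.
Proof.
rewrite (expand_det_row _ 0) !big_ord_recl big_ord0 /cofactor !det_mx11 !mxE /=.
by ring.
Qed.

Lemma mul_mx2 a b c d a' b' c' d' : mx2 a b c d *m mx2 a' b' c' d' =
  mx2 (a * a' + b * c') (a * b' + b * d') (c * a' + d * c') (c * b' + d * d').
Proof.
apply/matrixP=> i j; rewrite !mxE !big_ord_recl big_ord0 !mxE /= addr0.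
by case: (i == 0); case: (j == 0).
Qed.

Lemma mul_mx2_cv2 a b c d s t :
  mx2 a b c d *m cv2 s t = cv2 (a * s + b * t) (c * s + d * t).
Proof.
apply/matrixP=> i j; rewrite !mxE !big_ord_recl big_ord0 !mxE /= addr0.
by case: (i == 0).
Qed.

Lemma cv2_eq0 a b : (cv2 a b == 0) = (a == 0) && (b == 0).
Proof.
apply/eqP/andP=> [/matrixP e | [/eqP-> /eqP->]].
  by have := (e 0 0, e 1 0); rewrite !mxE /= => -[-> ->].
by apply/matrixP=> i j; rewrite !mxE; case: ifP.
Qed.

Lemma line_eq a b c d (v0 : cv2 a b != 0) (w0 : cv2 c d != 0) :
  (line v0 == line w0) = (a * d == b * c).
Proof.
apply/eqP/eqP=> [/(congr1 val)/= e | e].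
  have : cv2 a b \in <[cv2 c d]>%VS by rewrite -e memv_line.
  case/vlineP=> k /matrixP ek; have := (ek 0 0, ek 1 0).
  by rewrite !mxE /= => -[-> ->]; ring.
apply/val_inj/esym/(PG1_vline (P := line w0)) => //=.
have colinear k : a = k * c -> b = k * d -> cv2 a b \in <[cv2 c d]>%VS.
  move=> -> ->; apply/vlineP; exists k; apply/matrixP=> i j.
  by rewrite !mxE; case: ifP.
have [c0 | nc] := eqVneq c 0; last first.
  by apply: (colinear (a / c)); [field | apply: (mulIf nc); rewrite -e; field].
have nd : d != 0 by move: w0; rewrite cv2_eq0 c0 eqxx.
apply: (colinear (b / d)); last by field.
by apply: (mulIf nd); rewrite e; field.
Qed.

Fact inf_subproof : cv2 1 0 != 0.
Proof. by rewrite cv2_eq0 oner_eq0. Qed.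
Definition inf : PG1 F := line inf_subproof.

Fact aff_subproof t : cv2 t 1 != 0.
Proof. by rewrite cv2_eq0 oner_eq0 andbF. Qed.
Definition aff t : PG1 F := line (aff_subproof t).

Lemma aff_eq t u : (aff t == aff u) = (t == u).
Proof. by rewrite line_eq mulr1 mul1r. Qed.

Lemma aff_inf t : (aff t == inf) = false.
Proof. by rewrite line_eq mulr0 mulr1 eq_sym oner_eq0. Qed.

Lemma PG1_cv2 P : exists a b (v0 : cv2 a b != 0), P = line v0.
Proof.
have [v [v0 ->]] := PG1E P; rewrite [v]cv2E in v0 *.
by exists (v 0 0), (v 1 0), v0.
Qed.

Lemma PG1_cases P : P = inf \/ exists t, P = aff t.
Proof.
have [a [b [v0 ->]]] := PG1_cv2 P; have [b0|nb] := eqVneq b 0.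
  by left; apply/eqP; rewrite line_eq b0 mulr0 mul0r.
by right; exists (a / b); apply/eqP; rewrite line_eq; apply/eqP; field.
Qed.

Definition entry A (i j : 'I_2) : F := (GLval A : 'M[F]_2) i j.

Lemma GLvalE A :
  GLval A = mx2 (entry A 0 0) (entry A 0 1) (entry A 1 0) (entry A 1 1).
Proof. exact: mx2E. Qed.

Lemma entry_det A :
  entry A 0 0 * entry A 1 1 - entry A 0 1 * entry A 1 0 != 0.
Proof. by have := GL_unitmx A; rewrite unitmxE unitfE [val A]GLvalE det_mx2. Qed.

Fact gl2_subproof a b c d : a * d - b * c != 0 ->
  (mx2 a b c d : 'M[F]_2) \is a GRing.unit.
Proof. by rewrite -[_ \is a _]/(_ \in unitmx) unitmxE det_mx2 unitfE. Qed.
Definition gl2 a b c d (D : a * d - b * c != 0) : {'GL_2[F]} :=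
  FinRing.unit _ (gl2_subproof D).

Lemma gl2E a b c d (D : a * d - b * c != 0) : GLval (gl2 D) = mx2 a b c d.
Proof. by []. Qed.

Lemma entry_gl2 a b c d (D : a * d - b * c != 0) :
  (entry (gl2 D) 0 0 = a) * (entry (gl2 D) 0 1 = b)
  * (entry (gl2 D) 1 0 = c) * (entry (gl2 D) 1 1 = d).
Proof. by rewrite /entry gl2E !mxE. Qed.

Lemma pgl_act_line A s t s' t' (v0 : cv2 s t != 0) (w0 : cv2 s' t' != 0) :
  (pgl_act (coset (scalars F) A) (line v0) == line w0) =
  ((entry A 0 0 * s + entry A 0 1 * t) * t'
     == (entry A 1 0 * s + entry A 1 1 * t) * s').
Proof.
rewrite pgl_act_coset.
have Av : (GLval A : 'M[F]_2) *m cv2 s t =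
    cv2 (entry A 0 0 * s + entry A 0 1 * t) (entry A 1 0 * s + entry A 1 1 * t).
  by rewrite GLvalE mul_mx2_cv2.
have Av0 : cv2 (entry A 0 0 * s + entry A 0 1 * t)
    (entry A 1 0 * s + entry A 1 1 * t) != 0.
  rewrite -Av; apply: contraNneq v0 => /(congr1 (mulmx (invmx (GLval A)))).
  by rewrite mulKmx ?GL_unitmx // mulmx0 => ->.
by rewrite -(line_eq Av0); congr (_ == _); apply: val_inj; rewrite gl_act_line Av.
Qed.

Lemma pgl_act_aff_aff A t u : (pgl_act (coset (scalars F) A) (aff t) == aff u) =
  (entry A 0 0 * t + entry A 0 1 == (entry A 1 0 * t + entry A 1 1) * u).
Proof. by rewrite pgl_act_line !mulr1. Qed.

Lemma pgl_act_inf_inf A : (pgl_act (coset (scalars F) A) inf == inf) =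
  (entry A 1 0 == 0).
Proof. by rewrite pgl_act_line !mulr1 !mulr0 !addr0 eq_sym. Qed.

Lemma coset_scale A (B : {'GL_2[F]}) t : (GLval A : 'M[F]_2) = t *: GLval B ->
  coset (scalars F) A = coset (scalars F) B.
Proof.
move=> AB; apply/rcoset_kercosetP; rewrite ?norm_scalars // mem_rcoset inE.
apply/is_scalar_mxP; exists t; rewrite GL_MxE AB -scalemxAl GL_VxE.
by rewrite mulmxV ?GL_unitmx // scalemx1.
Qed.

Lemma base_transitive P Q R : uniq [:: P; Q; R] ->
  exists x, [/\ pgl_act x inf = P, pgl_act x (aff 0) = Q & pgl_act x (aff 1) = R].
Proof.
have [u0 [u1 [nu ->]]] := PG1_cv2 P; have [v0 [v1 [nv ->]]] := PG1_cv2 Q.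
have [w0 [w1 [nw ->]]] := PG1_cv2 R.
rewrite uniq3 !line_eq => /and3P[nuv nwu nwv].
(* By Cramer's rule [al * u + be * v] is a nonzero multiple of [w], so the matrix with columns
   [al * u] and [be * v] sends [inf], [aff 0], [aff 1] to the three given lines. *)
pose al := w0 * v1 - w1 * v0; pose be := u0 * w1 - u1 * w0.
have D : (al * u0) * (be * v1) - (be * v0) * (al * u1) != 0.
  rewrite (_ : _ - _ = (w0 * v1 - w1 * v0) * - (w0 * u1 - w1 * u0) * (u0 * v1 - u1 * v0)).
    by rewrite !mulf_neq0 ?oppr_eq0 ?subr_eq0.
  by rewrite /al /be; ring.
exists (coset (scalars F) (gl2 D)).
by split; apply/eqP; rewrite pgl_act_line !entry_gl2 /al /be; apply/eqP; ring.
Qed.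

Lemma base_free x : pgl_act x inf = inf -> pgl_act x (aff 0) = aff 0 ->
  pgl_act x (aff 1) = aff 1 -> x = 1%g.
Proof.
have [A ->] := PGL2P x => /eqP; rewrite pgl_act_inf_inf => /eqP A10.
move/eqP; rewrite pgl_act_aff_aff A10 !mulr0 add0r => /eqP A01.
move/eqP; rewrite pgl_act_aff_aff A10 A01 mul0r !mulr1 add0r addr0 => /eqP A00.
rewrite -[RHS](morph1 (coset (scalars F))); apply: (coset_scale (t := entry A 1 1)).
rewrite GLvalE A10 A01 A00 scalemx1; apply/matrixP=> i j; rewrite !mxE.
by case: i j => [[|[]]] // ? [[|[]]].
Qed.

End ProjectiveCoordinates.

(** * Sharp 3-transitivity, parabolic elements and derangements in coordinates *)

Section PGL2Action.

Variable F : finFieldType.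
Implicit Types (t u : F) (P Q R : PG1 F) (x y z g : PGL2 F) (A : {'GL_2[F]}).

Notation act := (@pgl_act F).
Notation cst := (coset (scalars F)).
Notation inf := (inf F).

Let actVK x : cancel (act x) (act x^-1) := act_invK (@pgl_actM F) (@pgl_act1 F) x.

Lemma base_uniq : uniq [:: inf; aff 0%R; aff (1%R : F)].
Proof.
by rewrite uniq3 eq_sym !aff_inf aff_eq oner_eq0.
Qed.

Lemma pgl_trans3 P Q R P' Q' R' : uniq [:: P; Q; R] -> uniq [:: P'; Q'; R'] ->
  exists x, [/\ act x P = P', act x Q = Q' & act x R = R'].
Proof.
move=> /base_transitive[x [<- <- <-]] /base_transitive[y [<- <- <-]].
by exists (y * x^-1); split; rewrite pgl_actM actVK.
Qed.

Lemma pgl_free3 x P Q R : uniq [:: P; Q; R] ->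
  act x P = P -> act x Q = Q -> act x R = R -> x = 1.
Proof.
move=> /base_transitive[y [<- <- <-]] xP xQ xR.
have: x ^ y = 1.
  by apply: base_free; rewrite conjgE !pgl_actM ?xP ?xQ ?xR actVK.
by move/eqP; rewrite conjg_eq1 => /eqP.
Qed.

Lemma card_PG1_gt2 : 2 < #|(PG1 F : finType)|.
Proof.
have := base_uniq; rewrite uniq3 => /and3P[n1 n2 n3].
apply/card_gt2P; exists inf, (aff 0%R), (aff 1%R).
split; [split; exact: isT | ].
split; first exact: n1.
  by rewrite eq_sym; exact: n3.
exact: n2.
Qed.

Let trans2 := act_trans2 pgl_trans3 card_PG1_gt2.

Fact affine_subproof (l : F) : l != 0%R -> (l * 1 - 1 * 0 != 0 :> F)%R.
Proof. by rewrite mulr1 mulr0 subr0. Qed.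
(** The matrix [[l, 1; 0, 1]] of the map t |-> l t + 1; its entries are read off
    [affine_subproof]. *)
Definition affine_gl (l : F) (l0 : l != 0%R) : {'GL_2[F]} := gl2 (affine_subproof l0).

(** A conjugate of t |-> t + 1, whose only fixed point is [inf]. *)
Lemma pgl_parabolic P : exists x, forall Q, (act x Q == Q) = (Q == P).
Proof.
have [R /andP[nR _]] := third_point card_PG1_gt2 P P.
have [y [_ yP]] := trans2 (negbT (aff_inf (0%R : F))) nR.
exists (cst (affine_gl (oner_neq0 F)) ^ y^-1) => Q.
rewrite conjgE invgK !pgl_actM -(inj_eq (@pgl_act_inj _ y^-1)) actVK.
rewrite -[RHS](inj_eq (@pgl_act_inj _ y^-1)) -yP actVK.
have [-> | [t ->]] := PG1_cases (act y^-1 Q).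
  by rewrite pgl_act_inf_inf /affine_gl !entry_gl2 !eqxx.
rewrite pgl_act_aff_aff /affine_gl !entry_gl2 aff_inf mul1r mul0r add0r mul1r.
by rewrite -subr_eq0 addrC addKr oner_eq0.
Qed.

(** Fixed points are eigenlines. A fixed [aff t] has eigenvalue [entry A 1 0 * t + entry A 1 1],
    which can be solved for [t] unless [entry A 1 0 = 0], and in that case [inf] is fixed. *)
Lemma derangement_coset A : derangement (pgl_perm (cst A)) =
  root_free (entry A 0 0 + entry A 1 1)%R
    (entry A 0 0 * entry A 1 1 - entry A 0 1 * entry A 1 0)%R.
Proof.
apply/forallP/forallP=> [dA u | rf P]; apply/negP; last first.
  rewrite permE; have [-> | [t ->]] := PG1_cases P.
    rewrite pgl_act_inf_inf => /eqP A10.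
    have /negP[] := rf (entry A 0%R 0%R).
    by rewrite /quad_root A10; apply/eqP; ring.
  rewrite pgl_act_aff_aff => /eqP e.
  have /negP[] := rf (entry A 1 0 * t + entry A 1 1)%R.
  rewrite /quad_root; apply/eqP.
  rewrite (_ : _ + _ = entry A 1 0 *
    ((entry A 1 0 * t + entry A 1 1) * t - (entry A 0 0 * t + entry A 0 1)))%R.
    by rewrite e subrr mulr0.
  by ring.
move=> rootu; have [A10|nA10] := eqVneq (entry A 1%R 0%R) 0%R.
  by have := dA inf; rewrite permE pgl_act_inf_inf A10 eqxx.
have := dA (aff ((u - entry A 1 1) / entry A 1 0)%R).
rewrite permE pgl_act_aff_aff; apply/negP/negPn; rewrite -subr_eq0.
move: rootu; rewrite /quad_root => /eqP r.
apply/eqP; apply: (mulfI nA10); rewrite mulr0 -[RHS]oppr0 -r; field; exact: nA10.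
Qed.

End PGL2Action.

(** * Counting common neighbours *)

Section CommonNeighbours.

Variable F : finFieldType.
Implicit Types (t u : F) (P Q R : PG1 F) (x y z g : PGL2 F) (A : {'GL_2[F]}).

Notation act := (@pgl_act F).
Notation cst := (coset (scalars F)).
Notation fixfree x := (derangement (pgl_perm x)).

Lemma card_coset_preim (Q : pred (PGL2 F)) :
  (#|scalars F| * #|[set x | Q x]| = #|[set A | Q (cst A)]|)%N.
Proof.
rewrite [#|[set x | Q x]|]card_set_sum [RHS]card_set_sum.
rewrite (partition_big (fun A => cst A) xpredT) //= big_distrr /=.
apply: eq_bigr => x _.
transitivity (\sum_(A | cst A == x) Q x); last by apply: eq_bigr => A /eqP->.
have [B ->] := PGL2P x; rewrite sum_nat_const; congr (_ * _)%N.
rewrite -(card_rcoset _ B); apply: eq_card => A.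
have -> : (A \in scalars F :* B) = (cst A == cst B).
  by apply/idP/eqP=> /rcoset_kercosetP; apply; rewrite norm_scalars.
by [].
Qed.

Lemma card_GL2 (R : pred 'M[F]_2) : (forall M, R M -> M \in unitmx) ->
  #|[set A : {'GL_2[F]} | R (GLval A)]| =
  \sum_c \sum_d \sum_a \sum_b R (mx2 a b c d).
Proof.
move=> Runit; transitivity (\sum_(M : 'M[F]_2) R M).
  rewrite -card_set_sum -(card_imset _ (val_inj : injective (@GLval 2 F))).
  apply: eq_card => M; rewrite inE; apply/imsetP/idP=> [[A] | RM].
    by rewrite inE => RA ->.
  by exists (FinRing.unit _ (Runit M RM)); rewrite ?inE.
rewrite pair_bigA /= pair_bigA /= pair_bigA /=.
rewrite (reindex (fun p : F * F * F * F => mx2 p.1.2 p.2 p.1.1.1 p.1.1.2)) //=.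
exists (fun M => (M 1 0, M 1 1, M 0 0, M 0 1)%R) => [[[[c d] a] b] _|M _] /=.
  by rewrite !mxE.
by rewrite -mx2E.
Qed.

Lemma fixfreeJ x y : fixfree (x ^ y) = fixfree x.
Proof.
apply/forallP/forallP=> nfix P; rewrite permE.
  have := nfix (act y^-1 P); rewrite permE conjgE !pgl_actM -(pgl_actM y).
  by rewrite mulgV pgl_act1 (inj_eq (@pgl_act_inj _ _)).
rewrite conjgE !pgl_actM -(inj_eq (@pgl_act_inj _ y)) -(pgl_actM y) mulgV pgl_act1.
by have := nfix (act y P); rewrite permE.
Qed.

Definition n_common x y :=
  #|[set z | derangement_graph F z x && derangement_graph F z y]|.

Definition n_fixfree_translates g := #|[set w | fixfree w && fixfree (g * w)]|.

(** Substitute [z = x * w]. *)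
Lemma n_commonE x y : n_common x y = n_fixfree_translates (y^-1 * x).
Proof.
rewrite /n_common -(card_imset _ (mulgI x^-1)); apply: eq_card => w.
rewrite inE; apply/imsetP/idP=> [[z] | w_ok].
  by rewrite inE /derangement_graph => ? ->; rewrite mulgA mulgK.
by exists (x * w); rewrite ?mulKg // inE /derangement_graph mulKg mulgA.
Qed.

Lemma n_fixfree_translatesJ g y : n_fixfree_translates (g ^ y) = n_fixfree_translates g.
Proof.
rewrite /n_fixfree_translates -[RHS](card_imset _ (@conjg_inj _ y)).
apply: eq_card => w; rewrite inE; apply/idP/imsetP=> [w_ok | [z]].
  exists (w ^ y^-1); rewrite ?conjgKV // inE fixfreeJ.
  by rewrite -[fixfree (g * _)](fixfreeJ _ y) conjMg conjgKV.
by rewrite inE => z_ok ->; rewrite -conjMg !fixfreeJ.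
Qed.

Lemma n_fixfree_translates_affine (l : F) (l0 : l != 0%R) :
  (#|scalars F| * n_fixfree_translates (cst (affine_gl l0)) = n_root_free_pair l)%N.
Proof.
rewrite card_coset_preim.
pose R (M : 'M[F]_2) :=
  root_free (M 0 0 + M 1 1)%R (M 0 0 * M 1 1 - M 0 1 * M 1 0)%R &&
  root_free (l * M 0 0 + M 1 0 + M 1 1)%R (l * (M 0 0 * M 1 1 - M 0 1 * M 1 0))%R.
transitivity #|[set A : {'GL_2[F]} | R (GLval A)]|.
  apply: eq_card => A; rewrite !inE -morphM ?norm_scalars //= !derangement_coset.
  have LA : GLval (affine_gl l0 * A) = mx2 (l * entry A 0 0 + entry A 1 0)%R
      (l * entry A 0 1 + entry A 1 1)%R (entry A 1 0)%R (entry A 1 1)%R.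
    rewrite GL_MxE [GLval A in LHS]GLvalE gl2E mul_mx2.
    by congr mx2; ring.
  rewrite /entry LA !mxE /= /R; congr (_ && root_free _ _).
  by rewrite /entry; ring.
(* Since 0 is not a root of the characteristic polynomial, the determinant is nonzero, so counting
   over all matrices adds nothing. *)
rewrite card_GL2 => [|M /andP[/forallP/(_ 0%R) M0 _]]; last first.
  rewrite unitmxE unitfE [M]mx2E det_mx2; apply: contraNneq M0 => e.
  by rewrite /quad_root e; apply/eqP; ring.
apply: eq_bigr => c _; apply: eq_bigr => d _; apply: eq_bigr => a _.
by apply: eq_bigr => b _; rewrite /R !mxE.
Qed.

End CommonNeighbours.

(** * Graph automorphisms preserve agreement *)

Section AgreementInvariance.

Variable F : finFieldType.
Implicit Types (t u : F) (P Q R : PG1 F) (x y z g : PGL2 F) (A : {'GL_2[F]}).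

Notation act := (@pgl_act F).
Notation cst := (coset (scalars F)).
Notation inf := (inf F).
Notation fixfree x := (derangement (pgl_perm x)).

Definition n_fix g := #|[set P | act g P == P]|.

Lemma n_fixJ g y : n_fix (g ^ y) = n_fix g.
Proof.
rewrite /n_fix -[RHS](card_imset _ (@pgl_act_inj _ y^-1)); apply: eq_card => P.
rewrite inE conjgE !pgl_actM; apply/eqP/imsetP=> [eP | [Q]].
  exists (act y P); last by rewrite -pgl_actM mulVg pgl_act1.
  by rewrite inE -{2}eP -(pgl_actM y) mulgV pgl_act1.
by rewrite inE => /eqP gQ ->; rewrite -(pgl_actM y) mulgV pgl_act1 gQ.
Qed.

Lemma n_fix_affine (l : F) (l0 : l != 0%R) :
  n_fix (cst (affine_gl l0)) = (l != 1%R).+1.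
Proof.
have fix_aff t : (act (cst (affine_gl l0)) (aff t) == aff t) = ((1 - l) * t == 1)%R.
  rewrite pgl_act_aff_aff /affine_gl !entry_gl2 mul0r add0r mul1r.
  by rewrite mulrBl mul1r subr_eq eq_sym [(1 + _)%R]addrC.
have fix_inf : act (cst (affine_gl l0)) inf == inf.
  by rewrite pgl_act_inf_inf /affine_gl !entry_gl2.
have [l1|nl1] := eqVneq l 1%R.
  transitivity #|[set inf]|; last by rewrite cards1.
  apply: eq_card => P; rewrite !inE.
  have [-> | [t ->]] := PG1_cases P; first by rewrite fix_inf eqxx.
  by rewrite fix_aff aff_inf l1 subrr mul0r eq_sym oner_eq0.
have nl : (1 - l != 0)%R by rewrite subr_eq0 eq_sym.
transitivity #|[set inf; aff (1 - l)^-1%R]|; last by rewrite cards2 eq_sym aff_inf.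
apply: eq_card => P; rewrite !inE.
have [-> | [t ->]] := PG1_cases P; first by rewrite fix_inf eqxx.
rewrite fix_aff aff_inf aff_eq /=; apply/eqP/eqP=> [e | ->]; last by rewrite mulfV.
by apply: (mulfI nl); rewrite e mulfV.
Qed.

Lemma agreeE x y : agree act x y = n_fix (y^-1 * x).
Proof.
apply: eq_card => P; rewrite !inE pgl_actM.
by rewrite -[RHS](inj_eq (@pgl_act_inj _ y)) -(pgl_actM y) mulgV pgl_act1.
Qed.

(** Take a fixed point [P], a moved point [Q] and [act g Q] as [inf], 0 and 1. The conjugate then
    fixes [inf] and sends 0 to 1, which after scaling is the affine form. *)
Lemma conj_affine g : g != 1 -> ~~ fixfree g ->
  exists y (l : F) (l0 : l != 0%R), g ^ y = cst (affine_gl l0).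
Proof.
move=> ng /forallPn[P]; rewrite negbK permE => /eqP gP.
have [Q nQ] : exists Q, act g Q != Q.
  apply/existsP; apply: contraNT ng => /existsPn fixg; apply/eqP/pgl_perm_inj.
  by apply/permP=> Q; rewrite !permE pgl_act1; apply/eqP; rewrite -[_ == _]negbK fixg.
have nPQ : P != Q by rewrite eq_sym; apply: contraNneq nQ => ->; rewrite gP.
have ngQP : act g Q != P.
  by apply: contraNneq nPQ => e; apply/eqP/(@pgl_act_inj _ g); rewrite e gP.
have [|y [yP yQ ygQ]] := @base_transitive F P Q (act g Q).
  by rewrite uniq3; apply/and3P; split; [exact: nPQ | exact: ngQP | exact: nQ].
have yV R : act y^-1 (act y R) = R by rewrite -pgl_actM mulVg pgl_act1.
have kinf : act (g ^ y) inf = inf by rewrite conjgE !pgl_actM yP gP -yP yV.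
have k0 : act (g ^ y) (aff 0%R) = aff 1%R by rewrite conjgE !pgl_actM yQ -ygQ yV.
exists y; move: kinf k0; have [A ->] := PGL2P (g ^ y).
move/eqP; rewrite pgl_act_inf_inf => /eqP A10.
move/eqP; rewrite pgl_act_aff_aff A10 !mulr0 !add0r mulr1 => /eqP A01.
have := entry_det A; rewrite A10 mulr0 subr0 mulf_eq0 negb_or => /andP[A00 A11].
have l0 : (entry A 0 0 / entry A 1 1 != 0)%R by rewrite mulf_neq0 ?invr_eq0.
exists (entry A 0 0 / entry A 1 1)%R, l0; apply: (@coset_scale _ _ _ (entry A 1%R 1%R)).
rewrite gl2E GLvalE A10 A01; apply/matrixP=> i j; rewrite !mxE.
by case: (i == 0%R); case: (j == 0%R); rewrite ?mulr1 ?mulr0 // mulrC divfK.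
Qed.

Lemma agree_n_common x y : x != y -> ~~ derangement_graph F x y ->
  exists2 l : F, l != 0%R & agree act x y = (l != 1%R).+1 /\
    (#|scalars F| * n_common x y = n_root_free_pair l)%N.
Proof.
move=> nxy nD; have [||z [l [l0 e]]] := @conj_affine (y^-1 * x); rewrite -?eq_mulVg1 //.
  by rewrite eq_sym.
exists l => //; rewrite agreeE n_commonE -(n_fixJ _ z) -(n_fixfree_translatesJ _ z) e.
by rewrite n_fix_affine n_fixfree_translates_affine.
Qed.

Lemma agree_eq0 x y : (agree act x y == 0%N) = derangement_graph F x y.
Proof.
rewrite agreeE cards_eq0 /derangement_graph /derangement.
apply/eqP/forallP=> [/setP e P | nfix]; first by have := e P; rewrite !inE permE => ->.
by apply/setP=> P; rewrite !inE; have := nfix P; rewrite permE => /negPf.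
Qed.

(** Equality and adjacency being preserved, only agreements 1 and 2 remain to be told apart, and the
    strict inequality between common-neighbour counts does so. *)
Lemma graph_aut_agree (s : {perm PGL2 F}) : s \in graph_aut (derangement_graph F) ->
  forall x y, agree act (s x) (s y) = agree act x y.
Proof.
move/graph_autP=> sD x y.
have [->|nxy] := eqVneq x y; first by rewrite !agreeE !mulVg.
have [D|nD] := boolP (derangement_graph F x y).
  have /eqP-> : agree act x y == 0%N by rewrite agree_eq0.
  by apply/eqP; rewrite agree_eq0 sD.
have common : n_common (s x) (s y) = n_common x y.
  rewrite /n_common -[RHS](card_imset _ (@perm_inj _ s)); apply: eq_card => z.
  rewrite inE; apply/idP/imsetP=> [z_ok | [w]].
    by exists (s^-1 z); rewrite ?permKV // inE -!(sD (s^-1 z)) permKV.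
  by rewrite inE => w_ok ->; rewrite !sD.
have [l l0 [-> cl]] := agree_n_common nxy nD.
have nsxy : s x != s y by rewrite (inj_eq (@perm_inj _ s)).
have nsD : ~~ derangement_graph F (s x) (s y) by rewrite sD.
have [m m0 [-> cm]] := agree_n_common nsxy nsD.
move: cm; rewrite common cl => lm.
have [l1|l1] := eqVneq l 1%R; have [m1|m1] := eqVneq m 1%R; try exact: erefl.
  by have := n_root_free_pair_lt m0 m1; rewrite -lm l1 ltnn.
by have := n_root_free_pair_lt l0 l1; rewrite lm m1 ltnn.
Qed.

End AgreementInvariance.

(** * The normaliser of PGL2 in the symmetric group of the projective line *)

Section Normalizer.

Variable F : finFieldType.
Implicit Types (t u : F) (P Q R : PG1 F) (x y z g : PGL2 F) (A : {'GL_2[F]}).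

Notation act := (@pgl_act F).
Notation cst := (coset (scalars F)).
Notation inf := (inf F).

Lemma map_cv2 (f : F -> F) b c : map_mx f (cv2 b c) = cv2 (f b) (f c).
Proof. by apply/matrixP=> i j; rewrite !mxE; case: ifP. Qed.

Lemma field_aut_act_inf a : field_aut_act a inf = inf.
Proof.
by apply: val_inj; rewrite field_aut_act_line map_cv2 rmorph1 rmorph0.
Qed.

Lemma field_aut_act_aff a u : field_aut_act a (aff u) = aff (field_aut_fun a u).
Proof.
by apply: val_inj; rewrite field_aut_act_line map_cv2 rmorph1.
Qed.

Fact translate_subproof (b : F) : (1 * 1 - b * 0 != 0 :> F)%R.
Proof. by rewrite mulr1 mulr0 subr0 oner_neq0. Qed.

Fact scale_subproof (m : F) : m != 0%R -> (m * 1 - 0 * 0 != 0 :> F)%R.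
Proof. by rewrite mulr1 mulr0 subr0. Qed.

Lemma normalizer_field_aut (t : PG1 F -> PG1 F) (f : PGL2 F -> PGL2 F) :
    injective t -> t inf = inf -> t (aff 0%R) = aff 0%R -> t (aff 1%R) = aff 1%R ->
    (forall x P, act (f x) (t P) = t (act x P)) ->
  exists a : field_aut F, forall x, f x = gamma a x.
Proof.
move=> t_inj tinf t0 t1 ft.
have [u|al t_aff] := @fin_all_exists _ (fun=> F) (fun u v => t (aff u) = aff v).
  have [e | //] := PG1_cases (t (aff u)).
  by have := aff_inf u; rewrite -(inj_eq t_inj) tinf e eqxx.
have al_inj : injective al.
  by move=> u v e; apply/eqP; rewrite -aff_eq -(inj_eq t_inj) !t_aff e eqxx.
have al0 : al 0%R = 0%R by apply/eqP; rewrite -aff_eq -t_aff t0.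
have al1 : al 1%R = 1%R by apply/eqP; rewrite -aff_eq -t_aff t1.
have fix_inf x A : f x = cst A -> act x inf = inf -> entry A 1%R 0%R = 0%R.
  move=> fA xinf; have := ft x inf; rewrite xinf tinf fA => /eqP.
  by rewrite pgl_act_inf_inf => /eqP.
have map_aff x A u v : f x = cst A -> act x inf = inf -> act x (aff u) = aff v ->
    (entry A 0 0 * al u + entry A 0 1 = entry A 1 1 * al v)%R.
  move=> fA xinf xu; have := ft x (aff u); rewrite xu !t_aff fA => /eqP.
  by rewrite pgl_act_aff_aff (fix_inf _ _ fA xinf) mul0r add0r => /eqP.
have A11_neq0 x A : f x = cst A -> act x inf = inf -> entry A 1%R 1%R != 0%R.
  move=> fA xinf; have := entry_det A.
  by rewrite (fix_inf _ _ fA xinf) mulr0 subr0 mulf_eq0 negb_or => /andP[].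
have alD u b : (al (u + b) = al u + al b)%R.
  pose x := cst (gl2 (translate_subproof b)).
  have xinf : act x inf = inf.
    by apply/eqP; rewrite pgl_act_inf_inf entry_gl2.
  have xaff v : act x (aff v) = aff (v + b)%R.
    by apply/eqP; rewrite pgl_act_aff_aff !entry_gl2 mul1r mul0r add0r mul1r.
  have [A fA] := PGL2P (f x).
  have Au v := map_aff _ _ v _ fA xinf (xaff v); have A11 := A11_neq0 _ _ fA xinf.
  have A01 := Au 0%R; rewrite al0 mulr0 !add0r in A01.
  (* Otherwise the affine map [f x] fixes some [al v], so the translation by [b] fixes [v] and
     [b = 0]; then [A] acts trivially and its diagonal entries agree after all. *)
  have A00 : entry A 0%R 0%R = entry A 1%R 1%R.
    apply/eqP; rewrite eq_sym -subr_eq0; apply/negPn/negP=> nA.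
    pose v := invF al_inj (entry A 0 1 / (entry A 1 1 - entry A 0 0))%R.
    have al_v : (entry A 0 0 * al v + entry A 0 1 = entry A 1 1 * al v)%R.
      by rewrite f_invF; field.
    have /eqP := Au v; rewrite al_v => /eqP/(mulfI A11)/al_inj/eqP.
    rewrite -subr_eq0 opprD addNKr oppr_eq0 => /eqP b0.
    have := Au 1%R; rewrite A01 b0 addr0 al0 al1 !mulr1 mulr0 addr0 => e.
    by rewrite e subrr eqxx in nA.
  by apply: (mulfI A11); rewrite -Au A00 A01 mulrDr.
have alM m u : (al (m * u) = al m * al u)%R.
  have [->|m0] := eqVneq m 0%R; first by rewrite mul0r al0 mul0r.
  pose x := cst (gl2 (scale_subproof m0)).
  have xinf : act x inf = inf.
    by apply/eqP; rewrite pgl_act_inf_inf entry_gl2.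
  have xaff v : act x (aff v) = aff (m * v)%R.
    by apply/eqP; rewrite pgl_act_aff_aff !entry_gl2 mul0r add0r mul1r addr0.
  have [A fA] := PGL2P (f x).
  have Au v := map_aff _ _ v _ fA xinf (xaff v); have A11 := A11_neq0 _ _ fA xinf.
  have A01 := Au 0%R; rewrite mulr0 al0 !mulr0 add0r in A01.
  have A00 := Au 1%R; rewrite mulr1 al1 mulr1 A01 addr0 in A00.
  by apply: (mulfI A11); rewrite -Au A01 A00 addr0 mulrA.
have aut : is_field_aut (perm al_inj).
  rewrite /is_field_aut permE al1 eqxx /=.
  by apply/andP; split; apply/forallP=> u; apply/forallP=> v; rewrite !permE ?alD ?alM.
pose a : field_aut F := exist _ (perm al_inj) aut.
have aE P : field_aut_perm a P = t P.
  rewrite permE; have [-> | [u ->]] := PG1_cases P.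
    by rewrite field_aut_act_inf tinf.
  by rewrite field_aut_act_aff t_aff /field_aut_fun /= permE.
exists a => x; apply: pgl_perm_inj; rewrite permE pgl_perm_gamma_fun.
apply/permP=> Q; rewrite conjgE !permM -{1}(permKV (field_aut_perm a) Q).
by rewrite [RHS]aE aE !permE ft.
Qed.

End Normalizer.

(** * The automorphism group *)

Section RegularProducts.

Variable gT : finGroupType.
Implicit Types (g h x : gT).

Lemma psiJ_lambda g : lambda g ^ psi gT = rho g.
Proof.
apply/permP=> x; rewrite conjgE !permM -{1}(permKV (psi gT) x).
rewrite permK lambdaE rhoE !psiE; set y := _ x.
by rewrite -[x](permKV (psi gT)) -/y psiE invMg.
Qed.

Lemma psi_mul : psi gT * psi gT = 1.
Proof. by apply/permP=> x; rewrite permM !psiE invgK perm1. Qed.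

Lemma psiJ_rho g : rho g ^ psi gT = lambda g.
Proof. by rewrite -psiJ_lambda -conjgM psi_mul conjg1. Qed.

Lemma cycle_psi s : s \in <[psi gT]> -> s = 1 \/ s = psi gT.
Proof.
case/cycleP=> i ->; rewrite -(odd_double_half i) -mul2n expgD expgM.
rewrite [psi gT ^+ 2]expgS expg1 psi_mul expg1n mulg1.
by case: (odd i); [right; rewrite expg1 | left; rewrite expg0].
Qed.

Lemma regular_cent : right_regular gT \subset 'C(left_regular gT).
Proof.
apply/centsP=> _ /imsetP[h _ ->] _ /imsetP[g _ ->]; apply/permP=> x.
by rewrite !permM !lambdaE !rhoE mulgA.
Qed.

Lemma regular_TI : (forall g, (forall x, g * x = x * g) -> g = 1) ->
  left_regular gT :&: right_regular gT = 1.
Proof.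
move=> Z1; apply/trivgP/subsetP=> s /setIP[/imsetP[g _ ->] /imsetP[h _ /permP e]].
have hg : h^-1 = g by have := e 1; rewrite lambdaE rhoE mulg1 mul1g.
rewrite (Z1 g) => [|x]; last by have := e x; rewrite lambdaE rhoE hg.
by apply/set1P/permP=> x; rewrite lambdaE perm1 mul1g.
Qed.

End RegularProducts.

(** * The factors, their products, and the reverse inclusion *)

Section DerangementGraphAutomorphisms.

Variable F : finFieldType.
Implicit Types (t u : F) (P Q R : PG1 F) (x y z g : PGL2 F) (a : field_aut F).

Notation act := (@pgl_act F).
Notation G := (PGL2 F).
Notation inf := (inf F).
Notation Aut_graph := (graph_aut (derangement_graph F)).
Notation L := (left_regular_group G).
Notation R := (right_regular_group G).
Notation C := (cycle_group (psi G)).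
Notation H := (gamma_Aut_group F).

Lemma pgl_permM x y : pgl_perm (x * y) = pgl_perm y * pgl_perm x.
Proof. by apply/permP=> P; rewrite permM !permE pgl_actM. Qed.

Lemma gammaM a x y : gamma a (x * y) = gamma a x * gamma a y.
Proof.
by apply: pgl_perm_inj; rewrite !permE pgl_permM !pgl_perm_gamma_fun !pgl_permM conjMg.
Qed.

Lemma gamma1 a : gamma a 1 = 1.
Proof. by apply: (mulgI (gamma a 1)); rewrite -gammaM !mulg1. Qed.

Lemma gammaV a x : gamma a x^-1 = (gamma a x)^-1.
Proof. by apply: (mulgI (gamma a x)); rewrite -gammaM !mulgV gamma1. Qed.

Lemma derangementJ (T : finType) (s r : {perm T}) : derangement (s ^ r) = derangement s.
Proof.
apply/forallP/forallP=> nfix P.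
  by have := nfix (r P); rewrite conjgE !permM permK (inj_eq perm_inj).
by rewrite conjgE !permM -{2}(permKV r P) (inj_eq perm_inj).
Qed.

Lemma lambda_aut g : lambda g \in Aut_graph.
Proof.
apply/graph_autP=> x y; rewrite !lambdaE /derangement_graph invMg.
by rewrite -mulgA mulKg.
Qed.

Lemma rho_aut g : rho g \in Aut_graph.
Proof.
apply/graph_autP=> x y; rewrite !rhoE /derangement_graph.
by rewrite -(fixfreeJ (y^-1 * x) g^-1) conjgE invMg !mulgA.
Qed.

Lemma psi_aut : psi G \in Aut_graph.
Proof.
apply/graph_autP=> x y; rewrite !psiE [RHS]derangement_graph_sym /derangement_graph.
by rewrite -(fixfreeJ (x^-1 * y) x^-1) conjgE !invgK -mulgA mulKVg.
Qed.

Lemma gamma_aut a : gamma a \in Aut_graph.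
Proof.
apply/graph_autP=> x y; rewrite /derangement_graph -gammaV -gammaM.
by rewrite permE pgl_perm_gamma_fun derangementJ.
Qed.

(** A central element fixes the unique fixed point of every parabolic element, hence every point. *)
Lemma pgl_center g : (forall x, g * x = x * g) -> g = 1.
Proof.
move=> gC; apply: pgl_perm_inj; apply/permP=> P; rewrite !permE pgl_act1.
have [x fixx] := pgl_parabolic P; apply/eqP; rewrite -fixx.
have xP : act x P = P by apply/eqP; rewrite fixx.
by rewrite -pgl_actM -gC pgl_actM xP.
Qed.

Lemma pgl_not_abelian : ~ (forall x y, x * y = y * x).
Proof.
move=> abelG; have [x fixx] := pgl_parabolic inf.
have x1 : x = 1 by apply: pgl_center => y; apply: abelG.
by have := fixx (aff 0%R); rewrite x1 pgl_act1 eqxx aff_inf.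
Qed.

(** Comparing fixed points of parabolic elements shows that [g] acts on the line as [a] does; in
    particular it fixes [inf], 0 and 1. *)
Lemma gamma_inner a g : (forall x, gamma a x = g * x * g^-1) -> g = 1.
Proof.
move=> ag.
have gE P : act g P = field_aut_act a P.
  have [x fixx] := pgl_parabolic P; have xP : act x P = P by apply/eqP; rewrite fixx.
  have : act (gamma a x) (field_aut_act a P) = field_aut_act a P.
    have := pgl_perm_gamma_fun a x => /permP/(_ (field_aut_perm a P)).
    by rewrite conjgE !permM permK !permE xP.
  rewrite ag !pgl_actM => e; apply/eqP; rewrite eq_sym -(inj_eq (@pgl_act_inj _ g^-1)).
  rewrite -(pgl_actM g^-1 g) mulVg pgl_act1 -fixx.
  by apply/eqP/(@pgl_act_inj _ g); rewrite e -pgl_actM mulgV pgl_act1.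
by apply: base_free; rewrite gE ?field_aut_act_inf // field_aut_act_aff ?rmorph0 ?rmorph1.
Qed.

Lemma left_right_dprod : L \x R = L <*> R.
Proof. exact: dprodEY (regular_cent G) (regular_TI pgl_center). Qed.

Lemma psi_gamma_dprod : C \x H = C <*> H.
Proof.
apply: dprodEY.
  rewrite centsC cycle_subG; apply/centP=> _ /imsetP[a _ ->].
  by apply/permP=> x; rewrite !permM !psiE gammaV.
apply/trivgP/subsetP=> s /setIP[/cycle_psi[-> _|->]]; first exact: set11.
(* Inversion reverses products and [gamma a] preserves them, so their equality would make the group
   abelian. *)
case/imsetP=> a _ /permP e; case: pgl_not_abelian => x y.
apply: invg_inj; rewrite !invMg.
by have := e (y * x); rewrite gammaM -!e !psiE invMg.
Qed.

Lemma gammaJ_lambda a g : lambda g ^ gamma a = lambda (gamma a g).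
Proof.
apply/permP=> x; rewrite conjgE !permM !lambdaE gammaM.
by rewrite permKV.
Qed.

Lemma gammaJ_rho a g : rho g ^ gamma a = rho (gamma a g).
Proof.
apply/permP=> x; rewrite conjgE !permM !rhoE gammaM gammaV.
by rewrite permKV.
Qed.

Lemma psi_gamma_norm : C <*> H \subset 'N(L <*> R).
Proof.
rewrite join_subG cycle_subG; apply/andP; split.
  rewrite inE conjYg [L <*> R]joingC; apply: genS; apply: setUSS.
    by apply/subsetP=> _ /imsetP[_ /imsetP[g _ ->] ->]; rewrite psiJ_lambda imset_f.
  by apply/subsetP=> _ /imsetP[_ /imsetP[g _ ->] ->]; rewrite psiJ_rho imset_f.
apply/subsetP=> _ /imsetP[a _ ->]; rewrite inE conjYg; apply: genS; apply: setUSS.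
  by apply/subsetP=> _ /imsetP[_ /imsetP[g _ ->] ->]; rewrite gammaJ_lambda imset_f.
by apply/subsetP=> _ /imsetP[_ /imsetP[g _ ->] ->]; rewrite gammaJ_rho imset_f.
Qed.

Lemma regular_psi_gamma_TI : (L <*> R) :&: (C <*> H) = 1.
Proof.
apply/trivgP/subsetP=> s /setIP[].
rewrite -(dprodW left_right_dprod) -(dprodW psi_gamma_dprod).
case/mulsgP=> _ _ /imsetP[g _ ->] /imsetP[h _ ->] ->.
case/mulsgP=> c _ /cycle_psi c_psi /imsetP[a _ ->] /permP e.
(* Evaluation at 1, which [c] and [gamma a] both fix. The common element is then conjugation by [g]:
   [gamma_inner] handles [c = 1], and non-commutativity excludes [c = psi]. *)
have gh : h = g.
  have := e 1; rewrite !permM lambdaE rhoE mulg1.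
  have -> : c 1 = 1 by case: c_psi => ->; rewrite ?perm1 ?psiE ?invg1.
  by rewrite gamma1 => /eqP; rewrite -eq_mulgV1 => /eqP.
have {}e x : g * x * g^-1 = gamma a (c x) by have := e x; rewrite !permM lambdaE rhoE gh.
case: c_psi => def_c; rewrite {}def_c in e.
  have g1 : g = 1 by apply: (@gamma_inner a) => x; rewrite e perm1.
  apply/set1P/permP=> x; rewrite gh g1 permM lambdaE rhoE perm1.
  by rewrite mul1g invg1 mulg1.
have {}e x : gamma a x^-1 = g * x * g^-1 by rewrite e psiE.
case: pgl_not_abelian => x y; apply: (mulgI g); apply: (mulIg g^-1).
by rewrite -e invMg gammaM !e !mulgA mulgKV.
Qed.

Lemma derangement_graph_autS : Aut_graph \subset (L <*> R) <*> (C <*> H).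
Proof.
pose K := ((L <*> R) <*> (C <*> H))%G.
have LK g : lambda g \in K.
  by apply: mem_gen; rewrite inE mem_gen // inE imset_f.
have RK g : rho g \in K.
  by apply: mem_gen; rewrite inE mem_gen // inE orbC imset_f.
have CK : psi G \in K.
  by apply: mem_gen; rewrite inE orbC mem_gen // inE cycle_id.
have HK a : gamma a \in K.
  by apply: mem_gen; rewrite inE orbC mem_gen // inE orbC imset_f.
apply/subsetP=> s s_aut; change (s \in K).
pose s1 := s * lambda (s 1)^-1.
have s1_aut : s1 \in Aut_graph by rewrite groupM ?lambda_aut.
have s1_1 : s1 1 = 1 by rewrite permM lambdaE mulVg.
suff s1K : s1 \in K by rewrite -(mulgK (lambda (s 1)^-1) s) groupM ?groupV.
have [t t_inj ts] := agree_perm_act (@pgl_actM F) (@pgl_act1 F) (@pgl_trans3 F)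
  (@pgl_free3 F) (card_PG1_gt2 F) (graph_aut_agree s1_aut) (@pgl_parabolic F) s1_1.
have [s2 s2K {}ts] : exists2 s2 : {perm G}, s2 \in K -> s1 \in K &
    forall x P, act (s2 x) (t P) = t (act x P).
  case: ts => ts; first by exists s1.
  exists (s1 * psi G) => [|x P]; last by rewrite permM psiE ts.
  by rewrite groupMr.
apply: s2K.
have [g [gi g0 g1]] : exists g, [/\ act g inf = t inf, act g (aff 0%R) = t (aff 0%R)
    & act g (aff 1%R) = t (aff 1%R)].
  apply: base_transitive.
  exact: etrans (map_inj_uniq t_inj [:: inf; aff 0%R; aff 1%R]) (base_uniq F).
have gK P : act g^-1 (act g P) = P by rewrite -pgl_actM mulVg pgl_act1.
(* Conjugating by [g^-1] replaces [t] by [g^-1] after [t], which fixes [inf], 0 and 1 as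
   [normalizer_field_aut] requires. *)
pose s3 := s2 * (lambda g^-1 * rho g^-1).
have [||||x P|a s3a] := @normalizer_field_aut F (fun P => act g^-1 (t P)) s3.
- by move=> P Q /pgl_act_inj/t_inj.
- by rewrite -gi gK.
- by rewrite -g0 gK.
- by rewrite -g1 gK.
- rewrite !permM lambdaE rhoE invgK !pgl_actM -(pgl_actM g) mulgV pgl_act1.
  by rewrite ts.
have : s3 \in K by rewrite (_ : s3 = gamma a) //; apply/permP.
by rewrite groupMr // groupM.
Qed.

End DerangementGraphAutomorphisms.

Theorem theorem1p1 (F : finFieldType) :
  (left_regular (PGL2 F) \x right_regular (PGL2 F))
      ><| (<[psi (PGL2 F)]> \x gamma_Aut F)
    = graph_aut (derangement_graph F).
Proof.
(* The products [\x] and [><|] collapse to the empty set when their side conditions fail, so the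
   equation also asserts commutation, normalisation and trivial intersections. *)
rewrite left_right_dprod psi_gamma_dprod.
rewrite (sdprodEY (psi_gamma_norm F) (regular_psi_gamma_TI F)).
apply/eqP; rewrite eqEsubset derangement_graph_autS andbT !join_subG cycle_subG psi_aut.
have sub (T : finType) (f : T -> {perm PGL2 F}) :
    (forall x, f x \in graph_aut (derangement_graph F)) ->
  [set f x | x : T] \subset graph_aut (derangement_graph F).
  by move=> fA; apply/subsetP=> _ /imsetP[x _ ->].
by rewrite !sub //; [exact: gamma_aut | exact: rho_aut | exact: lambda_aut].
Qed.
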